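(* Let $0 < p_1, p_2, \theta_1, \theta_2 < \infty$ and $\theta_2 \neq p_2 \le p_1 = \theta_1$. Assume that $v_1, v_2 \in \mathcal{W}(\mathbb{R}^n)$, $\omega_1 \in {}^{\mathbf c}\Omega_{\theta_1}$ and $\omega_2 \in \Omega_{\theta_2}$. Write $\|\mathrm{I}\|$ for $\|\mathrm{I}\|_{{}^{\mathbf c}LM_{p_1\theta_1,\omega_1}(\mathbb{R}^n,v_1)\to LM_{p_2\theta_2,\omega_2}(\mathbb{R}^n,v_2)}$. (i) If $p_1 \le \theta_2$, then $$\|\mathrm{I}\| \approx \sup_{t\in(0,\infty)} \Big\| \|\omega_1\|_{p_1,(0,|\cdot|)}^{-1}\Big\|_{p_1\to p_2,\,v_1^{-1}v_2,\,B(0,t)}\, \|\omega_2\|_{\theta_2,(t,\infty)}.$$ (ii) If $\theta_2 < p_1$, then $$\|\mathrm{I}\| \approx \left( \int_0^\infty \Big\| \|\omega_1\|_{p_1,(0,|\cdot|)}^{-1}\Big\|_{p_1\to p_2,\,v_1^{-1}v_2,\,B(0,t)}^{p_1\to\theta_2}\, d\Big(-\|\omega_2\|_{\theta_2,(t,\infty)}^{p_1\to\theta_2}\Big)\right)^{\frac{1}{p_1\to\theta_2}}.$$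
   Context: Let $n\ge 1$. For measurable $A$ (in $\mathbb{R}^n$ or $\mathbb{R}$), $\mathfrak{M}(A)$ is the set of measurable functions on $A$, $\mathfrak{M}^+(A)$ the non-negative ones, and $\mathcal{W}(A)$ the set of weights: measurable functions that are positive and finite a.e. on $A$. For $p\in(0,\infty]$, $\|f\|_{p,A}=(\int_A|f|^p)^{1/p}$ if $p<\infty$ and $\|f\|_{\infty,A}=\operatorname{ess\,sup}_A|f|$. For a non-negative measurable $w$, $\|f\|_{p,w,A}:=\|fw\|_{p,A}$ (the weight is inside the power). $B(0,t)$ is the open ball of radius $t$ centred at $0$ and ${}^{\mathbf c}B(0,t)=\mathbb{R}^n\setminus B(0,t)$. For $0<p,\theta\le\infty$, $\omega\in\mathfrak{M}^+(0,\infty)$, $v\in\mathcal{W}(\mathbb{R}^n)$: - $LM_{p\theta,\omega}(\mathbb{R}^n,v)$ is the set of $f\in L^{\rm loc}_{p,v}(\mathbb{R}^n)$ (i.e. $\|f\|_{p,v,K}<\infty$ for compact $K$) with $\|f\|_{LM_{p\theta,\omega}(\mathbb{R}^n,v)}:=\big\|\,t\mapsto\|f\|_{p,v,B(0,t)}\big\|_{\theta,\omega,(0,\infty)}<\infty$; - ${}^{\mathbf c}LM_{p\theta,\omega}(\mathbb{R}^n,v)$ is the set of $f\in\bigcap_{t>0}L_{p,v}({}^{\mathbf c}B(0,t))$ (i.e. $\|f\|_{p,v,{}^{\mathbf c}B(0,t)}<\infty$ for all $t>0$) with $\|f\|_{{}^{\mathbf c}LM_{p\theta,\omega}(\mathbb{R}^n,v)}:=\big\|\,t\mapsto\|f\|_{p,v,{}^{\mathbf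 c}B(0,t)}\big\|_{\theta,\omega,(0,\infty)}<\infty$. $\Omega_\theta=\{\omega\in\mathfrak{M}^+(0,\infty):0<\|\omega\|_{\theta,(t,\infty)}<\infty\ \forall t>0\}$ and ${}^{\mathbf c}\Omega_\theta=\{\omega\in\mathfrak{M}^+(0,\infty):0<\|\omega\|_{\theta,(0,t)}<\infty\ \forall t>0\}$. $\|\mathrm{I}\|_{X\to Y}\in[0,\infty]$ is the least constant $c$ with $\|f\|_Y\le c\|f\|_X$ for all $f\in X$ ($\infty$ if there is none). For $0<p,q\le\infty$, the symbol $p\to q$ used as an exponent denotes the number defined by $\frac1{p\to q}=\frac1q-\frac1p$ if $q<p$, and $p\to q=\infty$ if $q\ge p$. Integrals $\int_0^\infty F(t)\,d(G(t))$ with $G$ non-decreasing are Lebesgue–Stieltjes integrals over $(0,\infty)$. $A\approx B$ means $\lambda^{-1}B\le A\le\lambda B$ with $\lambda\ge1$ depending only on inessential parameters, i.e. on $n$ and the exponents $p_i,\theta_i$, but not on the weights (in particular one side is infinite iff the other is). Conventions: $0/0=0$, $0\cdot(\pm\infty)=0$, $1/(\pm\infty)=0$. *)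

(* Defs.v *)
From HB Require Import structures.
From mathcomp Require Import all_boot all_order all_algebra.
From mathcomp Require Import all_classical all_reals all_analysis.
From mathcomp Require Import measurable_realfun.

Set Implicit Arguments.
Unset Strict Implicit.
Unset Printing Implicit Defensive.

Import Order.TTheory GRing.Theory Num.Theory.
Import numFieldNormedType.Exports.

Local Open Scope classical_set_scope.
Local Open Scope ring_scope.
Local Open Scope ereal_scope.

Section lebesgue_outer_measure.
Context (R : realType) (n : nat).

(* The dimension is n.+1, so that it ranges over all integers >= 1. *)
Definition box (ab : 'rV[R]_n.+1 * 'rV[R]_n.+1) : set 'rV[R]_n.+1 :=
  [set x | forall i, (ab.1 ord0 i < x ord0 i <= ab.2 ord0 i)%R].

Definition box_volume (ab : 'rV[R]_n.+1 * 'rV[R]_n.+1) : \bar R :=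
  (\prod_i Num.max 0 (ab.2 ord0 i - ab.1 ord0 i)%R)%:E.

Definition box_cover (A : set 'rV[R]_n.+1) :
    set (nat -> 'rV[R]_n.+1 * 'rV[R]_n.+1) :=
  [set B | A `<=` \bigcup_k box (B k)].

Definition lebesgue_outer (A : set 'rV[R]_n.+1) : \bar R :=
  ereal_inf [set \sum_(k <oo) box_volume (B k) | B in box_cover A].

Lemma box_volume_ge0 ab : 0 <= box_volume ab.
Proof. by rewrite lee_fin prodr_ge0// => i _; rewrite le_max lexx. Qed.
#[local] Hint Resolve box_volume_ge0 : core.

Lemma lebesgue_outer_ge0 A : 0 <= lebesgue_outer A.
Proof. by apply: le_ereal_inf_tmp => _ [B _ <-]; exact: nneseries_ge0. Qed.

Lemma lebesgue_outer0 : lebesgue_outer set0 = 0.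
Proof.
apply/eqP; rewrite eq_le lebesgue_outer_ge0 andbT.
apply: ereal_inf_lbound; exists (fun=> (0%R, 0%R)) => //.
apply: eseries0 => k _ _.
by rewrite /box_volume big_ord_recl/= subrr maxxx mul0r.
Qed.

Lemma le_lebesgue_outer :
  {homo lebesgue_outer : A B / A `<=` B >-> A <= B}.
Proof.
move=> A B AB; apply/ereal_inf_le_tmp => _ [C BC <-].
by exists C => //; exact: subset_trans AB BC.
Qed.

Lemma lebesgue_outer_sigma_subadditive : sigma_subadditive lebesgue_outer.
Proof.
move=> A; have [[i ioo]|] := pselect (exists i, lebesgue_outer (A i) = +oo).
  rewrite (eseries_pinfty _ _ ioo) ?leey// => k _.
  by rewrite -ltNye (lt_le_trans _ (lebesgue_outer_ge0 _)).
rewrite -forallNE => Aoo.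
suff add2e (e : {posnum R}) : lebesgue_outer (\bigcup_k A k) <=
    \sum_(i <oo) lebesgue_outer (A i) + e%:num%:E.
  by apply/lee_addgt0Pr => _/posnumP[].
rewrite (le_trans _ (epsilon_trick _ _ _))//; last first.
  by move=> k; exact: lebesgue_outer_ge0.
pose P k B := box_cover (A k) B /\
  \sum_(j <oo) box_volume (B j)
    <= lebesgue_outer (A k) + (e%:num / (2 ^ k.+1)%:R)%:E.
have [G PG] : {G & forall k, P k (G k)}.
  apply: (@choice _ _ P) => k; rewrite /P /lebesgue_outer.
  set S := (X in ereal_inf X); move infS : (ereal_inf S) => iS.
  case: iS infS => [r Sr|Soo|Soo].
  - have en1 : (0 < e%:num / (2 ^ k.+1)%:R)%R by [].
    have /(lb_ereal_inf_adherent en1) : ereal_inf S \is a fin_num by rewrite Sr.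
    move=> [x [B AB muBx] xS].
    by exists B; split => //; rewrite muBx -Sr; exact/ltW.
  - by have := Aoo k; rewrite /lebesgue_outer Soo.
  - suff : lbound S 0 by move/le_ereal_inf_tmp; rewrite Soo.
    by move=> /= _ [B AB <-]; exact: nneseries_ge0.
pose g (ij : nat * nat) := box_volume (G ij.1 ij.2).
have g_ge0 x : 0 <= g x by exact: box_volume_ge0.
apply: (@le_trans _ _ (\esum_(i in setT) g i)).
  apply: ereal_inf_lbound => /=.
  have /card_esym/ppcard_eqP[f] := card_nat2.
  exists (fun k => G (f k).1 (f k).2).
    move=> t [i _ Ait]; have [j _ Bijt] := (PG i).1 t Ait.
    by exists (f^-1%FUN (i, j)) => //=; rewrite invK ?inE.
  rewrite -(esum_pred_image g _ xpredT) ?[fun=> _]set_true//.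
  by rewrite image_eq.
rewrite (_ : esum _ _ = \sum_(i <oo) \sum_(j <oo) box_volume (G i j)); last first.
  pose J : nat -> set (nat * nat) := fun i => [set (i, j) | j in setT].
  rewrite (_ : setT = \bigcup_k J k); last first.
    by rewrite predeqE => -[a b]; split => // _; exists a => //; exists b.
  rewrite esum_bigcupT /=; last 2 first.
    - apply/trivIsetP => i j _ _ ij.
      rewrite predeqE => -[k m] /=; split => //= -[] [_] _ [<-{k} _].
      by move=> [m' _] [] /esym/eqP; rewrite (negbTE ij).
    - by move=> ?; exact: box_volume_ge0.
  rewrite -(image_id [set: nat]) -fun_true esum_pred_image//; last first.
    by move=> k _; exact: esum_ge0.
  apply: eq_eseriesr => /= j _.
  rewrite -(esum_pred_image g (pair j) predT)//=; last first.
    by move=> ? ? _ _; exact: (@can_inj _ _ _ snd).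
  by congr esum; rewrite predeqE => -[a b]; split; move=> [i _ <-]; exists i.
apply: lee_lim.
- apply: is_cvg_nneseries => k *.
  exact: nneseries_ge0.
- by apply: is_cvg_nneseries => k *; apply: adde_ge0 => //;
    exact: lebesgue_outer_ge0.
- by near=> k; apply: lee_sum => i _; exact: (PG i).2.
Unshelve. all: by end_near. Qed.

HB.instance Definition _ := isOuterMeasure.Build R _ lebesgue_outer
  lebesgue_outer0 lebesgue_outer_ge0 le_lebesgue_outer
  lebesgue_outer_sigma_subadditive.

End lebesgue_outer_measure.
Arguments lebesgue_outer {R n}.

(* Caratheodory's construction: the measurable sets of this space are exactly
   the Lebesgue measurable subsets of R^(n+1). *)
Definition lebesgue_measure_rV {R : realType} {n : nat} :
    set (caratheodory_type (@lebesgue_outer R n)) -> \bar R :=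
  lebesgue_outer.
HB.instance Definition _ (R : realType) (n : nat) :=
  isMeasure.Build _ _ _ (@lebesgue_measure_rV R n)
    (@caratheodory_measure0 R _ (@lebesgue_outer R n))
    (@caratheodory_measure_ge0 R _ (@lebesgue_outer R n))
    (@caratheodory_measure_sigma_additive R _ (@lebesgue_outer R n)).

Section morrey.
Context {R : realType}.

(* Functions are extended-real valued, as weights are only finite a.e. *)

(* ||f||_{p,A}; the weighted norm ||f||_{p,w,A} is norm_rV p A (f \* w). *)
Definition norm_rV {n : nat} (p : \bar R) (A : set 'rV[R]_n.+1)
    (f : 'rV[R]_n.+1 -> \bar R) : \bar R :=
  'N[lebesgue_measure_rV]_p[f \_ A].

Definition norm_R (p : \bar R) (A : set R) (f : R -> \bar R) : \bar R :=
  'N[completed_lebesgue_measure]_p[f \_ A].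

Definition measurable_rV {n : nat} (f : 'rV[R]_n.+1 -> \bar R) :=
  measurable_fun setT (f : caratheodory_type (@lebesgue_outer R n) -> \bar R).

Definition measurable_pos (f : R -> \bar R) :=
  @measurable_fun _ _ (caratheodory_type (@wlength R idfun)^*%mu) _
    `]0%R, +oo[ (f : _ -> \bar R).

Definition weight {n : nat} (v : 'rV[R]_n.+1 -> \bar R) :=
  measurable_rV v /\
  {ae lebesgue_measure_rV, forall x, 0 < v x /\ v x < +oo}.

Definition Omega (theta : \bar R) (omega : R -> \bar R) :=
  [/\ measurable_pos omega,
      forall t, (0 < t)%R -> 0 <= omega t &
      forall t, (0 < t)%R ->
        0 < norm_R theta `]t, +oo[ omega /\ norm_R theta `]t, +oo[ omega < +oo].

Definition cOmega (theta : \bar R) (omega : R -> \bar R) :=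
  [/\ measurable_pos omega,
      forall t, (0 < t)%R -> 0 <= omega t &
      forall t, (0 < t)%R ->
        0 < norm_R theta `]0%R, t[ omega /\ norm_R theta `]0%R, t[ omega < +oo].

(* The norm that mathcomp-analysis puts on 'rV is the sup norm. *)
Definition euclid {n : nat} (x : 'rV[R]_n.+1) : R :=
  Num.sqrt (\sum_i x ord0 i ^+ 2).

Definition Ball {n : nat} (t : R) : set 'rV[R]_n.+1 :=
  [set x | (euclid x < t)%R].

Definition LM_norm {n : nat} (p theta : \bar R) (omega : R -> \bar R)
    (v f : 'rV[R]_n.+1 -> \bar R) : \bar R :=
  norm_R theta `]0%R, +oo[ (fun t => norm_rV p (Ball t) (f \* v) * omega t).

Definition LM {n : nat} (p theta : \bar R) (omega : R -> \bar R)
    (v : 'rV[R]_n.+1 -> \bar R) : set ('rV[R]_n.+1 -> \bar R) :=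
  [set f | [/\ measurable_rV f,
     forall K, compact K -> norm_rV p K (f \* v) < +oo &
     LM_norm p theta omega v f < +oo]].

Definition cLM_norm {n : nat} (p theta : \bar R) (omega : R -> \bar R)
    (v f : 'rV[R]_n.+1 -> \bar R) : \bar R :=
  norm_R theta `]0%R, +oo[ (fun t => norm_rV p (~` Ball t) (f \* v) * omega t).

Definition cLM {n : nat} (p theta : \bar R) (omega : R -> \bar R)
    (v : 'rV[R]_n.+1 -> \bar R) : set ('rV[R]_n.+1 -> \bar R) :=
  [set f | [/\ measurable_rV f,
     forall t, (0 < t)%R -> norm_rV p (~` Ball t) (f \* v) < +oo &
     cLM_norm p theta omega v f < +oo]].

(* Norm of the identity map from X to Y; +oo (the infimum of the empty set) if
   X is not contained in Y or if no constant works. *)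
Definition embedding_norm {F : Type} (X Y : set F) (normX normY : F -> \bar R) :
    \bar R :=
  ereal_inf [set c%:E | c in [set c : R | (0 <= c)%R /\
    forall f, X f -> Y f /\ normY f <= c%:E * normX f]].

(* p -> q, with 1/(p -> q) = 1/q - 1/p if q < p *)
Definition arrow (p q : \bar R) : \bar R :=
  if q < p then (q^-1 - p^-1)^-1 else +oo.

(* m is a Lebesgue-Stieltjes measure of the non-decreasing function G on
   (0, +oo): G need not extend to a finite function at 0, so that
   lebesgue_stieltjes_measure does not apply. This determines m on the Borel
   subsets of (0, +oo); mzero below is only a default value. *)
Definition is_stieltjes (G : R -> \bar R)
    (m : {measure set (measurableTypeR R) -> \bar R}) :=
  forall a b : R, (0 < a)%R -> (a <= b)%R ->
    m `]a, b]%classic = lim (G s @[s --> b^'+]) - lim (G s @[s --> a^'+]).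

Definition stieltjes_measure (G : R -> \bar R) :
    {measure set (measurableTypeR R) -> \bar R} :=
  if pselect (exists m, is_stieltjes G m) is left h then projT1 (cid h)
  else mzero.

Definition stieltjes_integral (F G : R -> \bar R) : \bar R :=
  \int[stieltjes_measure G]_(t in `]0%R, +oo[) F t.

Definition equiv_up_to (lambda : R) (A B : \bar R) :=
  lambda^-1%:E * B <= A /\ A <= lambda%:E * B.

End morrey.

(* Main.v *)
(** By Tonelli, since p1 = theta1, the complementary Morrey norm of f is the
    weighted L_p1 norm of f * v1 * V, where V(x) is the norm of omega1 over
    (0, |x|).  The embedding is therefore the Hardy-type inequality
      || t |-> ||g u||_(p2, B(0,t)) ||_(theta2, omega2) <= c ||g||_(p1),
    with u = v2 / (v1 V).  Cut (0, oo) at points t_k along which the tail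
    w(t) = int_t^oo omega2^theta2 decreases geometrically.  Both sides become
    geometric sums over k, in which norms over the balls B(0, t_k) may be
    replaced by norms over the shells between consecutive balls.  Sufficiency
    is then Hoelder's inequality on every shell followed by Jensen's
    (p1 <= theta2) or Young's (theta2 < p1) inequality in k; necessity tests
    the inequality on sums of near-extremals for Hoelder's inequality supported
    in the shells. *)
Require Import Defs.
From HB Require Import structures.
From mathcomp Require Import all_boot all_order all_algebra.
From mathcomp Require Import all_classical all_reals all_analysis.
From mathcomp Require Import measurable_realfun ess_sup_inf lra ring.
Import Order.TTheory GRing.Theory Num.Theory.
Import numFieldNormedType.Exports.

Local Open Scope classical_set_scope.
Local Open Scope ring_scope.
Local Open Scope ereal_scope.

(** * Powers of extended reals and the exponent p -> q *)

(** All exponents may lie below 1, so neither duality nor the triangle inequality is available: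
    Hoelder's inequality comes from a pointwise Young inequality and its converse from explicit
    functions. These are only nearly extremal, since the p1 -> p2 norm may be infinite or, for p1 =
    p2, an unattained essential supremum. The tail w may have a finite or an infinite limit at 0.
    Hence the cutting sequences run in one direction from an arbitrary starting point, the whole
    ball B(0, t_0) counts as the first shell, and all estimates concern finite sums, uniformly in
    the sequence and its length. The integral against omega2^theta2 dt and the Stieltjes integral in
    (ii) enter only through [tail_functional]: each is comparable with the supremum of such sums,
    with constants that depend on the ratio b and on the exponent of w alone. The ratio is thus
    free, and is chosen from the exponents so that [sum_geometric_absorb] can replace balls by
    shells. Disjointness of the shells makes the p1-th powers of norms add and lets near-extremals
    be summed without interfering. *)

Section extended_powers.
Context {R : realType}.
Implicit Types (x y : \bar R) (p q r s : R).

Lemma le_poweR r x y : (0 <= r)%R -> 0 <= x -> x <= y -> x `^ r <= y `^ r.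
Proof.
move=> r0 x0 xy; apply: gt0_ler_poweR => //.
  by rewrite in_itv/= x0 leey.
by rewrite in_itv/= (le_trans x0 xy) leey.
Qed.

Lemma poweRK r x : r != 0%R -> 0 <= x -> (x `^ r) `^ r^-1 = x.
Proof. by move=> r0 x0; rewrite -poweRrM divff// poweRe1. Qed.

Lemma poweRVK r x : r != 0%R -> 0 <= x -> (x `^ r^-1) `^ r = x.
Proof. by move=> r0 x0; rewrite -poweRrM mulVf// poweRe1. Qed.

Lemma lee_poweRV r x y : (0 < r)%R -> 0 <= x -> 0 <= y ->
  (x `^ r <= y) = (x <= y `^ r^-1).
Proof.
move=> r0 x0 y0; apply/idP/idP => [xy|xy].
  by rewrite -[leLHS](poweRK r)// ?gt_eqF// le_poweR ?invr_ge0 ?(ltW r0)// poweR_ge0.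
by rewrite -[leRHS](poweRVK r)// ?gt_eqF// le_poweR ?(ltW r0).
Qed.

Lemma lee_poweR2 r x y : (0 < r)%R -> 0 <= x -> 0 <= y ->
  (x `^ r <= y `^ r) = (x <= y).
Proof. by move=> r0 x0 y0; rewrite lee_poweRV ?poweR_ge0// poweRK ?gt_eqF. Qed.

Lemma poweR_addr1 r x : (0 < r)%R -> 0 <= x -> x `^ r * x = x `^ (r + 1).
Proof.
move=> r0 x0; rewrite poweRD ?poweRe1//.
by apply: add_neq0_poweRD_def; rewrite gt_eqF// addr_gt0.
Qed.

Let poweRM_le_dominant p q s x y : (0 < s)%R -> (0 < p)%R -> (0 < q)%R ->
  (q^-1 = s^-1 + p^-1)%R -> 0 <= x -> 0 <= y ->
  x `^ s <= y `^ p -> (x * y) `^ q <= y `^ p.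
Proof.
move=> s0 p0 q0 qsp x0 y0; rewrite lee_poweRV ?poweR_ge0// -poweRrM => xy.
apply: (@le_trans _ _ ((y `^ (p / s) * y) `^ q)).
  by rewrite le_poweR ?(ltW q0) ?mule_ge0// lee_wpmul2r.
rewrite poweR_addr1 ?divr_gt0// -poweRrM (_ : (_ * q)%R = p)//.
have -> : (p / s + 1 = p * q^-1)%R by rewrite qsp mulrDr divff// gt_eqF.
by rewrite divfK// gt_eqF.
Qed.

(** If [x ^ s <= y ^ p] then [x <= y ^ (p / s)], so [(x * y) ^ q <= y ^ ((p / s + 1) * q) = y ^ p];
    the other case is symmetric. No exponent has to be at least 1, and the values may be
    infinite. *)
Lemma poweRM_young p q s x y : (0 < s)%R -> (0 < p)%R -> (0 < q)%R ->
  (q^-1 = s^-1 + p^-1)%R -> 0 <= x -> 0 <= y ->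
  (x * y) `^ q <= x `^ s + y `^ p.
Proof.
move=> s0 p0 q0 qsp x0 y0; have [xy|/ltW yx] := leP (x `^ s) (y `^ p).
  by rewrite (le_trans (@poweRM_le_dominant _ _ s _ _ _ _ _ _ _ _ xy))// leeDr ?poweR_ge0.
rewrite muleC (le_trans (@poweRM_le_dominant _ _ p _ _ _ _ _ _ _ _ yx))//.
  by rewrite addrC.
by rewrite leeDl ?poweR_ge0.
Qed.

(** Young's inequality for [x / a] and [y / b]. Once [a] and [b] bound the norms of the two factors,
    each summand integrates or sums to at most 1, which turns the sum into a product. *)
Lemma poweRM_weighted_young p q s x y (a b : R) : (0 < s)%R -> (0 < p)%R ->
  (0 < q)%R -> (q^-1 = s^-1 + p^-1)%R -> 0 <= x -> 0 <= y ->
  (0 < a)%R -> (0 < b)%R ->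
  (x * y) `^ q <= ((a * b) `^ q)%:E *
    ((b `^ (- s))%:E * y `^ s + (a `^ (- p))%:E * x `^ p).
Proof.
move=> s0 p0 q0 q_inv x0 y0 a0 b0.
have aE (z : \bar R) (c t : R) : 0 <= z -> (0 < c)%R ->
    (c `^ (- t))%:E * z `^ t = (c^-1%:E * z) `^ t.
  move=> z0 c0; rewrite poweRM ?lee_fin ?invr_ge0 ?(ltW c0)// poweR_EFin.
  by rewrite -(powR_inv1 (ltW c0)) -powRrM mulN1r.
rewrite (aE y b s)// (aE x a p)//.
have -> : (x * y) `^ q = ((a * b) `^ q)%:E * ((b^-1%:E * y) * (a^-1%:E * x)) `^ q.
  rewrite -poweR_EFin -poweRM ?mule_ge0 ?lee_fin ?mulr_ge0 ?invr_ge0 ?(ltW a0) ?(ltW b0)//.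
  rewrite muleACA -EFinM !muleA -EFinM (mulrC b^-1%R) -invfM divff ?mul1e 1?muleC//.
  by rewrite mulf_neq0 ?gt_eqF.
rewrite lee_wpmul2l ?lee_fin ?powR_ge0//.
by apply: poweRM_young; rewrite ?mule_ge0 ?lee_fin ?invr_ge0 ?(ltW a0) ?(ltW b0).
Qed.

Lemma poweRD_le r x y : (0 <= r)%R -> 0 <= x -> 0 <= y ->
  (x + y) `^ r <= (2 `^ r)%:E * (x `^ r + y `^ r).
Proof.
move=> r0 x0 y0; rewrite -poweR_EFin.
wlog xy : x y x0 y0 / x <= y => [hw|].
  have [|/ltW] := leP x y; first exact: hw.
  by rewrite addeC [X in _ * X]addeC; exact: hw.
apply: (@le_trans _ _ ((2%:E * y) `^ r)).
  by rewrite le_poweR ?adde_ge0// (_ : 2 = 1 + 1)%R // EFinD ge0_muleDl// mul1e leeD2r.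
rewrite poweRM//.
by rewrite lee_wpmul2l ?poweR_ge0// leeDr ?poweR_ge0.
Qed.

Lemma arrow_lt p q : (0 < p)%R -> (0 < q)%R -> (q < p)%R ->
  arrow p%:E q%:E = ((q^-1 - p^-1)^-1)%:E.
Proof.
move=> p0 q0 qp; rewrite /arrow lte_fin qp !inver !gt_eqF// -EFinB inver.
by rewrite gt_eqF// subr_gt0 ltf_pV2.
Qed.

Lemma arrow_pp p : arrow p%:E p%:E = +oo.
Proof. by rewrite /arrow ltxx. Qed.

Lemma measurable_inve : measurable_fun [set: \bar R] (@inve R).
Proof.
move=> _; apply: (measurability _ (ErealGenOInfty.measurableE R)) => //.
move=> _ [_ [c ->] <-]; rewrite setTI.
have [c0|c0] := leP 0%R c.
  rewrite (_ : _ @^-1` _ = `[0, c%:E^-1[%classic); first exact: emeasurable_itv.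
  apply/seteqP; split=> x /=; rewrite !in_itv/= andbT.
    move=> cx; have x0 : 0 <= x by rewrite -inve_ge0 (le_trans _ (ltW cx))// lee_fin.
    by rewrite x0/= -inve_pgt// inE/= lee_fin.
  by move=> /andP[x0 xc]; rewrite inve_pgt// inE/= lee_fin.
rewrite (_ : _ @^-1` _ = `[0, +oo]%classic `|` `]-oo%E, c%:E^-1[%classic).
  by apply: measurableU; exact: emeasurable_itv.
apply/seteqP; split=> x /=; rewrite !in_itv/= andbT ?leey ?andbT.
  have [x0|x0] := leP 0 x; first by left.
  move=> cx; right; move: x x0 cx => [x||]//.
  rewrite lte_fin => x0; rewrite !inver !lt_eqF// ltNyr/= !lte_fin.
  by rewrite -[X in _ -> (X < _)%R]invrK ltf_nV2// negrE invr_lt0.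
case=> [x0|].
  by rewrite (@lt_le_trans _ _ 0)// ?lte_fin// inve_ge0.
move: x => [x||]//.
  rewrite inver lt_eqF// ltNyr/= lte_fin => xc.
  have x0 : (x < 0)%R by rewrite (lt_trans xc)// invr_lt0.
  by rewrite inver lt_eqF// lte_fin -[c]invrK ltf_nV2// negrE invr_lt0.
Qed.

Lemma cvge_ub (u_ : (\bar R)^nat) x y :
  u_ @ \oo --> x -> (forall n, u_ n <= y) -> x <= y.
Proof.
move=> ux uy; have /cvg_lim <- := ux; last exact: ereal_hausdorff.
apply: lime_le; first by apply/cvg_ex; exists x.
exact: nearW.
Qed.

End extended_powers.

(** * Norms over subsets, Hoelder's inequality and its near-extremals *)

Section restricted_norm.
Context d (T : measurableType d) (R : realType) (mu : {measure set T -> \bar R}).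
Implicit Types (S : set T) (f g u : T -> \bar R) (p q : R).

Lemma Lnorm_restrict_poweR S f p : p != 0%R ->
  'N[mu]_p%:E[f \_ S] `^ p = \int[mu]_(x in S) (`|f x| `^ p).
Proof.
move=> p0; rewrite poweR_Lnorm// [RHS]integral_mkcond.
apply: eq_integral => x _; rewrite /patch; case: ifP => // _.
by rewrite abse0 poweR0r.
Qed.

Lemma Lnorm_restrictE S f p : p != 0%R ->
  'N[mu]_p%:E[f \_ S] = (\int[mu]_(x in S) (`|f x| `^ p)) `^ p^-1.
Proof. by move=> p0; rewrite -Lnorm_restrict_poweR// poweRK// Lnorm_ge0. Qed.

Lemma Lnorm_pinfty_restrict_le S f (y : \bar R) : 0 <= y ->
  'N[mu]_+oo[f \_ S] <= y <-> {ae mu, forall x, S x -> `|f x| <= y}.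
Proof.
move=> y0; rewrite unlock /Lnorm; case: ifPn => [_|].
  split=> [/ess_supP|fy].
    by apply: filterS => x /=; rewrite /patch => + /mem_set Sx; rewrite Sx.
  apply/ess_supP; apply: filterS fy => x /= fy; rewrite /patch.
  by case: ifPn => [/set_mem/fy//|_]; rewrite abse0.
(* On a space of measure 0 the norm with exponent [+oo] is 0 by definition, and every property holds
   almost everywhere. *)
rewrite -leNgt => muT; split=> // _.
exists setT; split=> //; by apply/eqP; rewrite eq_le measure_ge0 muT.
Qed.

Lemma le_Lnorm_pinfty_restrict S S' f : S `<=` S' ->
  'N[mu]_+oo[f \_ S] <= 'N[mu]_+oo[f \_ S'].
Proof.
move=> SS'; apply/Lnorm_pinfty_restrict_le; first exact: Lnorm_ge0.
have /Lnorm_pinfty_restrict_le := lexx ('N[mu]_+oo[f \_ S']).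
by move=> /(_ (Lnorm_ge0 _ _ _)); apply: filterS => x h /SS'.
Qed.

Lemma measurable_poweR_comp S f p :
  measurable_fun S f -> measurable_fun S (fun x => f x `^ p).
Proof. by move=> mf; apply: (measurableT_comp (measurable_poweR p)). Qed.

End restricted_norm.

Section arrow_norm.
Context d (T : measurableType d) (R : realType) (mu : {measure set T -> \bar R}).
Variables (p q : R).
Hypotheses (p0 : (0 < p)%R) (q0 : (0 < q)%R) (qp : (q <= p)%R).
Implicit Types (S : set T) (f g u : T -> \bar R).

Let Psi u S := 'N[mu]_(arrow p%:E q%:E)[u \_ S].
Let s := ((q^-1 - p^-1)^-1)%R.

Let s_gt0 : (q < p)%R -> (0 < s)%R.
Proof. by move=> ltqp; rewrite invr_gt0 subr_gt0 ltf_pV2. Qed.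

Let q_inv : (q^-1 = s^-1 + p^-1)%R.
Proof. by rewrite invrK subrK. Qed.

(** Integrating the weighted Young inequality gives two terms of size at most [(a * b) ^ q], hence
    the factor 2. Positive bounds [a] and [b] in place of the norms avoid dividing by a vanishing
    norm. For [q = p] the norm of [u] is an essential supremum and the estimate is pointwise. *)
Lemma arrow_norm_hoelder S f u (a b : R) : measurable S ->
  measurable_fun S f -> measurable_fun S u ->
  (forall x, 0 <= f x) -> (forall x, 0 <= u x) -> (0 < a)%R -> (0 < b)%R ->
  \int[mu]_(x in S) (f x `^ p) <= (a `^ p)%:E -> Psi u S <= b%:E ->
  \int[mu]_(x in S) ((f x * u x) `^ q) <= (2 * (a * b) `^ q)%:E.
Proof.
move=> mS mf mu_ f0 u0 a0 b0 fa.
have mfu : measurable_fun S (fun x => (f x * u x) `^ q).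
  by apply: measurable_poweR_comp; exact: emeasurable_funM.
rewrite /Psi; move: qp; rewrite le_eqVlt => /predU1P[qEp|ltqp].
  rewrite qEp arrow_pp.
  move=> /Lnorm_pinfty_restrict_le; rewrite lee_fin (ltW b0) => /(_ isT) ub.
  apply: (@le_trans _ _ (\int[mu]_(x in S) ((b `^ p)%:E * f x `^ p))).
    apply: ae_ge0_le_integral => //.
    - by move=> x _; rewrite poweR_ge0.
    - by rewrite -qEp.
    - by move=> x _; rewrite mule_ge0 ?poweR_ge0 ?lee_fin ?powR_ge0.
    - by apply: emeasurable_funM => //; exact: measurable_poweR_comp.
    - apply: filterS ub => x + Sx => /(_ Sx); rewrite gee0_abs// => uxb.
      rewrite poweRM// muleC -poweR_EFin lee_wpmul2r ?poweR_ge0// le_poweR//.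
      exact: ltW.
  rewrite ge0_integralZl ?lee_fin ?powR_ge0//; last 2 first.
    exact: measurable_poweR_comp.
    by move=> x _; rewrite poweR_ge0.
  rewrite powRM ?(ltW a0) ?(ltW b0)//.
  apply: le_trans (lee_wpmul2l _ fa) _; first by rewrite lee_fin powR_ge0.
  by rewrite -EFinM lee_fin mulrC ler_peMl ?mulr_ge0 ?powR_ge0// ler1n.
rewrite arrow_lt// -/s => ub.
have {}ub : \int[mu]_(x in S) (u x `^ s) <= (b `^ s)%:E.
  under eq_integral do rewrite -(gee0_abs (u0 _)).
  rewrite -Lnorm_restrict_poweR ?gt_eqF ?s_gt0// -poweR_EFin le_poweR ?Lnorm_ge0//.
  exact/ltW/s_gt0.
apply: (@le_trans _ _ (\int[mu]_(x in S) (((a * b) `^ q)%:E *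
    ((b `^ (- s))%:E * u x `^ s + (a `^ (- p))%:E * f x `^ p)))).
  apply: ge0_le_integral => //.
  - by move=> x _; rewrite poweR_ge0.
  - apply: emeasurable_funM => //.
    by apply: emeasurable_funD; apply: emeasurable_funM => //; exact: measurable_poweR_comp.
  - by move=> x _; apply: poweRM_weighted_young => //; exact: s_gt0.
have ge0M (c t r : R) (g : T -> \bar R) x : 0 <= (c `^ t)%:E * g x `^ r.
  by rewrite mule_ge0 ?poweR_ge0 ?lee_fin ?powR_ge0.
have mM (c t r : R) (g : T -> \bar R) : measurable_fun S g ->
    measurable_fun S (fun x => (c `^ t)%:E * g x `^ r).
  by move=> mg; apply: emeasurable_funM => //; exact: measurable_poweR_comp.
rewrite ge0_integralZl ?lee_fin ?powR_ge0//; last 2 first.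
- by apply: emeasurable_funD; exact: mM.
- by move=> x _; rewrite adde_ge0.
rewrite (mulrC 2%R) [leRHS]EFinM lee_wpmul2l ?lee_fin ?powR_ge0//.
rewrite ge0_integralD//; [|exact: mM|exact: mM].
rewrite !ge0_integralZl ?lee_fin ?powR_ge0//;
  try by [exact: measurable_poweR_comp | move=> x _; rewrite poweR_ge0].
rewrite (_ : 2%R = 1 + 1)%R // EFinD leeD//.
  rewrite (_ : 1%R = b `^ (- s) * b `^ s)%R; last first.
    by rewrite powRN mulVf// gt_eqF// powR_gt0.
  by rewrite EFinM lee_wpmul2l// lee_fin powR_ge0.
rewrite (_ : 1%R = a `^ (- p) * a `^ p)%R; last first.
  by rewrite powRN mulVf// gt_eqF// powR_gt0.
by rewrite EFinM lee_wpmul2l// lee_fin powR_ge0.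
Qed.

End arrow_norm.

Section extremal.
Context d (T : measurableType d) (R : realType) (mu : {measure set T -> \bar R}).
Hypothesis mu_sigma_finite : sigma_finite setT mu.
Variables (p q : R).
Hypotheses (p0 : (0 < p)%R) (q0 : (0 < q)%R) (qp : (q <= p)%R).
Implicit Types (S D : set T) (g u h : T -> \bar R).

Lemma integral_patch S D h (F : T -> \bar R -> \bar R) : D `<=` S ->
  (forall x, F x 0 = 0) ->
  \int[mu]_(x in S) F x ((h \_ D) x) = \int[mu]_(x in D) F x (h x).
Proof.
move=> DS F0; rewrite integral_mkcond [RHS]integral_mkcond.
apply: eq_integral => x _; rewrite /patch.
case: ifPn => [//|/negP xS]; case: ifPn => // /set_mem /DS /mem_set //.
Qed.

Lemma sigma_finite_pos_subset D : measurable D -> 0 < mu D ->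
  exists D', [/\ measurable D', D' `<=` D, 0 < mu D' & mu D' < +oo].
Proof.
move=> mD D0; have [F [FT ndF mF]] := (sigma_finiteP _ _).1 mu_sigma_finite.
have mDF n : measurable (D `&` F n) by apply: measurableI => //; exact: (mF n).1.
suff [n Dn] : exists n, 0 < mu (D `&` F n).
  exists (D `&` F n); split => //; apply: le_lt_trans (mF n).2.
  by apply: le_measure; rewrite ?inE//; exact: (mF n).1.
apply/not_existsP => h.
suff : mu D <= 0 by rewrite leNgt D0.
have -> : D = \bigcup_n (D `&` F n) by rewrite -setI_bigcupr -FT setIT.
have ndDF : nondecreasing_seq (fun n => D `&` F n).
  by move=> m n mn; apply/subsetPset; apply: setIS; exact/subsetPset/ndF.
have := @nondecreasing_cvg_mu _ _ _ mu _ mDF (bigcupT_measurable _ mDF) ndDF.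
by move=> /cvge_ub; apply => n /=; rewrite leNgt; apply/negP/h.
Qed.

Let extremal u S (a : R) g := [/\ measurable_fun setT g, forall x, 0 <= g x,
  forall x, ~ S x -> g x = 0, \int[mu]_(x in S) (g x `^ p) <= 1 &
  (a `^ q)%:E <= \int[mu]_(x in S) ((g x * u x) `^ q)].

(** The extremal is the indicator of [D] divided by its p-norm. The lower bound on [u] covers two
    situations: for [p = q] the power of [mu D] is 1 and [u >= a] suffices, and where [u = +oo] it
    holds trivially. *)
Let extremal_indicator S D u (a : R) : measurable S -> measurable D ->
  D `<=` S -> 0 < mu D -> mu D < +oo -> measurable_fun setT u ->
  (0 <= a)%R -> (forall x, 0 <= u x) ->
  (forall x, D x -> (a * fine (mu D) `^ (p^-1 - q^-1))%:E <= u x) ->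
  exists g, extremal u S a g.
Proof.
move=> mS mD DS D0 Dy mu_ a0 u0 uD.
set M := fine (mu D) in uD *.
have ME : mu D = M%:E by rewrite fineK// ge0_fin_numE.
have M0 : (0 < M)%R by rewrite -lte_fin -ME.
pose c := (M `^ (- p^-1))%R.
exists ((cst c%:E) \_ D); split.
- by apply/(measurable_restrictT _ mD).
- by move=> x; rewrite /patch; case: ifP => // _; rewrite lee_fin powR_ge0.
- by move=> x Sx; rewrite /patch; case: ifPn => // /set_mem /DS.
- rewrite (@integral_patch S D _ (fun x y => y `^ p))// => [|x]; last first.
    by rewrite poweR0r// gt_eqF.
  rewrite (eq_integral (cst (c `^ p)%:E))// integral_cst// ME.
  rewrite -EFinM lee_fin /c -powRrM mulNr mulVf ?gt_eqF//.
  by rewrite powR_inv1 ?(ltW M0)// mulVf ?gt_eqF.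
- rewrite (@integral_patch S D _ (fun x y => (y * u x) `^ q))// => [|x]; last first.
    by rewrite mul0e poweR0r// gt_eqF.
  apply: (@le_trans _ _ (\int[mu]_(x in D) cst ((a `^ q * M^-1)%:E) x)).
    rewrite integral_cst// ME -EFinM lee_fin -mulrA mulVf ?gt_eqF// mulr1//.
  apply: ge0_le_integral => //.
  + by move=> x _; rewrite lee_fin mulr_ge0 ?powR_ge0// invr_ge0 ltW.
  + apply: measurable_poweR_comp; apply: emeasurable_funM => //.
    exact: measurable_funS mu_.
  + move=> x Dx /=.
    apply: (@le_trans _ _ ((c%:E * (a * M `^ (p^-1 - q^-1))%:E) `^ q)).
      rewrite -EFinM poweR_EFin lee_fin /c mulrCA -powRD; last first.
        by apply/implyP => _; rewrite gt_eqF.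
      rewrite addrA addNr add0r powRM ?powR_ge0// -powRrM mulNr mulVf ?gt_eqF//.
      by rewrite powR_inv1// ltW.
    rewrite le_poweR ?(ltW q0)//.
      by rewrite -EFinM lee_fin !mulr_ge0// powR_ge0.
    by rewrite lee_wpmul2l ?uD// lee_fin powR_ge0.
Qed.

Lemma arrow_norm_extremal S u (a : R) : measurable S ->
  measurable_fun setT u -> (forall x, 0 <= u x) -> (0 <= a)%R ->
  a%:E < 'N[mu]_(arrow p%:E q%:E)[u \_ S] ->
  exists g, [/\ measurable_fun setT g, forall x, 0 <= g x,
    forall x, ~ S x -> g x = 0, \int[mu]_(x in S) (g x `^ p) <= 1 &
    (a `^ q)%:E <= \int[mu]_(x in S) ((g x * u x) `^ q)].
Proof.
move=> mS mu_ u0 a0; move: (qp); rewrite le_eqVlt => /predU1P[qEp|ltqp].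
  have -> : arrow p%:E q%:E = +oo by rewrite qEp arrow_pp.
  move=> aN.
  pose D := S `&` [set x | a%:E < u x].
  have mD : measurable D by apply: emeasurable_fun_o_infty => //; exact: measurable_funS mu_.
  have [D' [mD' D'D D'0 D'y]] : exists D', [/\ measurable D', D' `<=` D, 0 < mu D' & mu D' < +oo].
    apply: sigma_finite_pos_subset => //; rewrite lt0e measure_ge0 andbT.
    apply/eqP => D0; move: aN; apply/negP; rewrite -leNgt.
    apply/Lnorm_pinfty_restrict_le; first by rewrite lee_fin.
    exists D; split => // x /= /not_implyP[Sx /negP]; rewrite -ltNge gee0_abs//.
  apply: (@extremal_indicator _ D') => //.
    by move=> x /D'D[].
  by move=> x /D'D [Sx /ltW]; rewrite qEp subrr powRr0 mulr1.
rewrite arrow_lt//; set s := ((q^-1 - p^-1)^-1)%R => aN.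
have s0 : (0 < s)%R by rewrite invr_gt0 subr_gt0 ltf_pV2.
(* If [u] is infinite on a set of positive measure, a normalised indicator already works; otherwise
   that set can be discarded. *)
have [uy|uy] := eqVneq (mu (S `&` [set x | u x = +oo])) 0; last first.
  have mS' : measurable (S `&` [set x | u x = +oo]).
    by apply: measurable_eqe => //; exact: measurable_funS mu_.
  have [D' [mD' D'D D'0 D'y]] : exists D', [/\ measurable D',
      D' `<=` S `&` [set x | u x = +oo], 0 < mu D' & mu D' < +oo].
    by apply: sigma_finite_pos_subset => //; rewrite lt0e uy measure_ge0.
  apply: (@extremal_indicator _ D') => //.
    by move=> x /D'D[].
  by move=> x /D'D[_ /= ->]; rewrite leey.
have [F [FT ndF mF]] := (sigma_finiteP _ _).1 mu_sigma_finite.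
(* Cutting off both the values of [u] and the measure of the domain makes the integral of [u ^ s]
   finite, so that it can be normalised; monotone convergence keeps it above [a ^ s]. *)
pose D n := (S `&` [set x | u x <= n%:R%:E]) `&` F n.
have mD n : measurable (D n).
  apply: measurableI; last exact: (mF n).1.
  by apply: emeasurable_fun_infty_c => //; exact: measurable_funS mu_.
have DS n : D n `<=` S by move=> x [[]].
have mus : measurable_fun setT (fun x => u x `^ s) by exact: measurable_poweR_comp.
have us0 x : 0 <= u x `^ s by exact: poweR_ge0.
have DE : S `\` (S `&` [set x | u x = +oo]) = \bigcup_n D n.
  apply/seteqP; split=> [x [Sx /not_andP[//|/eqP uxy]]|x [n _ [[Sx /= un] _]]].
    have [m _ Fm] : (\bigcup_i F i) x by rewrite -FT.
    have uxfin : u x \is a fin_num by rewrite ge0_fin_numE// lt_neqAle uxy leey.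
    exists (maxn m (Num.truncn (fine (u x))).+1) => //; split; first split => //=.
      rewrite -(fineK uxfin) lee_fin (le_trans (ltW (truncnS_gt _)))// ler_nat.
      exact: leq_maxr.
    by have /subsetPset := ndF _ _ (leq_maxl m (Num.truncn (fine (u x))).+1); exact.
  split=> // -[_ /= uxy]; by rewrite uxy in un.
have [N DN] : exists N, (a `^ s)%:E < \int[mu]_(x in D N) (u x `^ s).
  apply/not_existsP => h; move: aN; apply/negP; rewrite -leNgt.
  rewrite -(lee_poweR2 _ _ _ s0) ?Lnorm_ge0 ?lee_fin//.
  rewrite Lnorm_restrict_poweR ?gt_eqF//.
  under eq_integral do rewrite gee0_abs//.
  rewrite (@ge0_negligible_integral _ _ _ mu S (S `&` [set x | u x = +oo]))//; last 2 first.
  - by apply: measurable_eqe => //; exact: measurable_funS mu_.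
  - exact: measurable_funS mus.
  rewrite DE poweR_EFin.
  apply: (cvge_ub (fun n => \int[mu]_(x in D n) (u x `^ s))).
    apply: ge0_nondecreasing_set_cvg_integral => // [m n mn|n].
      apply/subsetPset => x [[Sx /= ux] Fx]; split; first split => //=.
        by rewrite (le_trans ux)// lee_fin ler_nat.
      by have /subsetPset := ndF _ _ mn; exact.
    exact: measurable_funS mus.
  by move=> n; rewrite leNgt; apply/negP/h.
pose M := fine (\int[mu]_(x in D N) (u x `^ s)).
have ME : \int[mu]_(x in D N) (u x `^ s) = M%:E.
  rewrite fineK// ge0_fin_numE; last by exact: integral_ge0.
  apply: (@le_lt_trans _ _ (\int[mu]_(x in D N) cst ((N%:R `^ s)%:E) x)).
    apply: ge0_le_integral => //; first exact: measurable_funS mus.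
    by move=> x [[_ /= ux] _]; rewrite -poweR_EFin le_poweR// ltW.
  rewrite integral_cst// lte_mul_pinfty ?lee_fin ?powR_ge0//.
  apply: le_lt_trans (mF N).2; apply: le_measure; rewrite ?inE//; first exact: (mF N).1.
  by move=> x [].
rewrite ME lte_fin in DN.
have M0 : (0 < M)%R by rewrite (le_lt_trans _ DN)// powR_ge0.
pose c := (M `^ (- p^-1))%R.
have c0 : 0 <= c%:E by rewrite lee_fin powR_ge0.
(* The equality case of Hoelder's inequality: [u ^ (s / p)] has p-th power [u ^ s] and, since
   [s / p + 1 = s / q], its product with [u] has q-th power [u ^ s] too. *)
exists ((fun x => c%:E * u x `^ (s / p)) \_ (D N)); split.
- apply/(measurable_restrictT _ (mD N)); apply: emeasurable_funM => //.
  by apply: measurable_poweR_comp; exact: measurable_funS mu_.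
- by move=> x; rewrite /patch; case: ifP => // _; rewrite mule_ge0 ?poweR_ge0.
- by move=> x Sx; rewrite /patch; case: ifPn => // /set_mem /DS.
- rewrite (@integral_patch S (D N) _ (fun x y => y `^ p))// => [|x]; last first.
    by rewrite poweR0r// gt_eqF.
  rewrite (eq_integral (fun x => (M^-1)%:E * u x `^ s)); last first.
    move=> x _; rewrite poweRM ?poweR_ge0// -poweRrM divfK ?gt_eqF//.
    rewrite poweR_EFin /c -powRrM mulNr mulVf ?gt_eqF//.
    by rewrite powR_inv1 ?(ltW M0).
  rewrite ge0_integralZl ?lee_fin ?invr_ge0 ?(ltW M0)//; last exact: measurable_funS mus.
  by rewrite ME -EFinM lee_fin mulVf ?gt_eqF.
- rewrite (@integral_patch S (D N) _ (fun x y => (y * u x) `^ q))// => [|x]; last first.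
    by rewrite mul0e poweR0r// gt_eqF.
  rewrite (eq_integral (fun x => (c `^ q)%:E * u x `^ s)); last first.
    move=> x _; rewrite -muleA poweR_addr1 ?divr_gt0// poweRM ?poweR_ge0//.
    rewrite -poweRrM poweR_EFin; congr (_ * _ `^ _).
    have -> : (s / p + 1 = s * q^-1)%R.
      have -> : (q^-1 = s^-1 + p^-1)%R by rewrite invrK subrK.
      by rewrite mulrDr divff ?gt_eqF// addrC.
    by rewrite divfK// gt_eqF.
  rewrite ge0_integralZl ?lee_fin ?powR_ge0//; last exact: measurable_funS mus.
  rewrite ME -EFinM lee_fin /c -powRrM -[X in (_ * X)%R](powRr1 (ltW M0)) -powRD; last first.
    by apply/implyP => _; rewrite gt_eqF.
  have -> : (- p^-1 * q + 1 = s^-1 * q)%R.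
    by rewrite invrK mulrBl mulVf ?gt_eqF// mulNr addrC.
  rewrite powRrM ge0_ler_powR ?nnegrE ?powR_ge0 ?(ltW q0)//.
  rewrite (_ : a = (a `^ s) `^ s^-1)%R; last by rewrite -powRrM divff ?gt_eqF// powRr1.
  apply: ge0_ler_powR; rewrite ?nnegrE ?powR_ge0 ?(ltW M0) ?(ltW DN)//; by rewrite invr_ge0 ltW.
Qed.

End extremal.

(** * Sums along geometric sequences *)

Section geometric_sums.
Context {R : realType}.

(* The factor [2 * C * beta <= 1] makes the weights decay faster than [A] can grow, so that [A k * x k] is absorbed into the previous term. *)
Lemma sum_geometric_absorb (A a : nat -> \bar R) (x : nat -> R) (C beta : R) :
  (forall k, 0 <= A k) -> (forall k, 0 <= a k) -> (forall k, 0 <= x k)%R ->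
  (0 <= C)%R -> (0 <= beta)%R -> (2 * C * beta <= 1)%R ->
  A 0%N <= C%:E * a 0%N -> (forall k, A k.+1 <= C%:E * (A k + a k.+1)) ->
  (forall k, x k.+1 = beta * x k)%R ->
  forall K, \sum_(k < K.+1) A k * (x k)%:E <=
    (2 * C)%:E * \sum_(k < K.+1) a k * (x k)%:E.
Proof.
move=> A0 a0 x0 C0 beta0 Cbeta Aa0 Aa xbeta K.
have ax0 k : 0 <= a k * (x k)%:E by rewrite mule_ge0// lee_fin.
have Ax0 k : 0 <= A k * (x k)%:E by rewrite mule_ge0// lee_fin.
(* The second copy of the last term pays for the term [2 * C * beta * (A K * x K)] created by the
   next step. *)
suff h : \sum_(k < K.+1) A k * (x k)%:E + A K * (x K)%:E <=
    (2 * C)%:E * \sum_(k < K.+1) a k * (x k)%:E.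
  by apply: le_trans h; rewrite leeDl.
have twice (y : \bar R) : y + y = 2%:E * y by rewrite (_ : 2%R = 1 + 1)%R // EFinD ge0_muleDl// mul1e.
elim: K => [|K IH].
  rewrite !big_ord1 twice EFinM -muleA lee_wpmul2l//.
  by rewrite muleA lee_wpmul2r ?lee_fin.
have recr (F : nat -> \bar R) :
  \sum_(k < K.+2) F k = \sum_(k < K.+1) F k + F K.+1 by rewrite big_ord_recr.
rewrite (recr (fun k => A k * (x k)%:E)) (recr (fun k => a k * (x k)%:E)) -addeA twice.
rewrite ge0_muleDr//; last by apply: sume_ge0.
have step : 2%:E * (A K.+1 * (x K.+1)%:E) <=
    A K * (x K)%:E + (2 * C)%:E * (a K.+1 * (x K.+1)%:E).
  apply: (@le_trans _ _ (2%:E * (C%:E * (A K + a K.+1) * (x K.+1)%:E))).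
    by rewrite lee_wpmul2l// lee_wpmul2r ?lee_fin.
  have -> : 2%:E * (C%:E * (A K + a K.+1) * (x K.+1)%:E) =
      (2 * C)%:E * (A K * (x K.+1)%:E) + (2 * C)%:E * (a K.+1 * (x K.+1)%:E).
    by rewrite muleA muleA -EFinM -muleA ge0_muleDl// ge0_muleDr ?mule_ge0 ?lee_fin.
  rewrite leeD2r// xbeta muleCA -EFinM mulrA lee_wpmul2l// lee_fin.
  by rewrite -[leRHS]mul1r ler_wpM2r.
apply: le_trans (leeD (lexx _) step) _.
by rewrite addeA leeD2r.
Qed.

(** The third clause combines continuity with decay to 0 at infinity: it is what finds points at
    which [w] takes prescribed smaller values. Near 0, [w] may be unbounded. *)
Definition tail_function (w : R -> R) :=
  [/\ forall s, (0 < s)%R -> (0 < w s)%R,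
      forall s t, (0 < s)%R -> (s <= t)%R -> (w t <= w s)%R &
      forall s y, (0 < s)%R -> (0 < y)%R -> (y <= w s)%R ->
        exists2 t, (s <= t)%R & w t = y].

(** A one-sided sequence from an arbitrary starting point: [w] may have a finite limit at 0, so a
    sequence indexed by all integers need not exist. *)
Definition geometric_seq (w : R -> R) (b : R) (t : nat -> R) :=
  [/\ (0 < t 0%N)%R, forall m n, (m <= n)%N -> (t m <= t n)%R &
      forall k, w (t k) = (w (t 0%N) / b ^+ k)%R].

Lemma geometric_seq_gt0 w b t k : geometric_seq w b t -> (0 < t k)%R.
Proof. by move=> [t0 ndt _]; apply: lt_le_trans t0 (ndt _ _ _). Qed.

Lemma exists_geometric_seq w b s : tail_function w -> (1 < b)%R -> (0 < s)%R ->
  exists2 t, geometric_seq w b t & t 0%N = s.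
Proof.
move=> [w0 ndw sw] b1 s0.
have b0 : (0 < b)%R by exact: lt_trans b1.
have /choice[f fP] (x : {x : R | (0 < x)%R}) :
    exists y : {y : R | (0 < y)%R}, (sval x <= sval y)%R /\
      w (sval y) = (w (sval x) / b)%R.
  case: x => x x0 /=.
  have [||y xy wy] := sw x (w x / b)%R x0.
  - by rewrite divr_gt0// w0.
  - by rewrite ler_pdivrMr// ler_peMr ?(ltW b1)// ltW// w0.
  - by exists (exist _ y (lt_le_trans x0 xy)).
pose t k := sval (iter k f (exist _ s s0)).
exists t => //; split => //.
- move=> m n mn; apply: (@homo_leq _ t (fun x y : R => x <= y)%R) => //.
    by move=> x y z; exact: le_trans.
  by move=> k; exact: (fP _).1.
- elim=> [|k IH]; first by rewrite expr0 divr1.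
  by rewrite {1}/t/= (fP _).2 -/(t k) IH exprSr invfM mulrA.
Qed.

Lemma geometric_seq_unbounded w b t S : tail_function w -> (1 < b)%R ->
  geometric_seq w b t -> exists K, (S <= t K)%R.
Proof.
move=> [w0 ndw _] b1 gt; have [t0 _ wt] := gt.
pose S' := Num.max S (t 0%N).
have S'0 : (0 < S')%R by rewrite lt_max t0 orbT.
have b0 : (0 < b)%R by exact: lt_trans b1.
have b11 : (`|b^-1| < 1)%R by rewrite ger0_norm ?invr_ge0 ?(ltW b0)// invf_lt1.
have /cvgrPdist_lt /(_ (w S' / w (t 0%N))%R) := cvg_expr b11.
rewrite divr_gt0 ?w0// => /(_ isT) [K _ /(_ K (leqnn _))] /=.
rewrite sub0r normrN ger0_norm ?exprn_ge0 ?invr_ge0 ?(ltW b0)//.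
rewrite ltr_pdivlMr ?w0// mulrC exprVn -wt => wK.
exists K; rewrite leNgt; apply/negP => tS; move: wK; apply/negP; rewrite -leNgt.
apply: ndw; first exact: geometric_seq_gt0 gt.
by rewrite le_max (ltW tS).
Qed.

Definition nondecreasing_pos (F : R -> \bar R) :=
  (forall t, (0 < t)%R -> 0 <= F t) /\
  (forall s t, (0 < s)%R -> (s <= t)%R -> F s <= F t).

(* [E F] plays the role of the integral of [F] against [d(- w ^ al)]. *)
Definition tail_functional (w : R -> R) (al : R) (E : (R -> \bar R) -> \bar R) :=
  forall b F, (1 < b)%R -> nondecreasing_pos F ->
    (forall t K, geometric_seq w b t ->
       \sum_(k < K) F (t k) * (w (t k) `^ al)%:E <=
       ((1 - b `^ (- al))^-1)%:E * E F) /\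
    (forall M, (forall t K, geometric_seq w b t ->
       \sum_(k < K) F (t k) * (w (t k) `^ al)%:E <= M) ->
       E F <= (b `^ al)%:E * M).

Lemma geometric_seq_powR w b t al k : tail_function w -> (1 < b)%R ->
  geometric_seq w b t ->
  (w (t k.+1) `^ al = b `^ (- al) * w (t k) `^ al)%R.
Proof.
move=> [w0 _ _] b1 [t0 _ wt].
have b0 : (0 < b)%R by exact: lt_trans b1.
rewrite wt exprSr invfM mulrA -wt mulrC powRM ?invr_ge0 ?(ltW b0)//.
  by rewrite -(powR_inv1 (ltW b0)) -powRrM mulN1r.
by rewrite wt divr_ge0 ?exprn_ge0 ?(ltW b0)// ltW// w0.
Qed.

End geometric_sums.

(** * Integrals against the decrements of a tail *)

Section line_functional.
Context {R : realType}.

Lemma nondecreasing_pos_measurable (F : R -> \bar R) :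
  nondecreasing_pos F -> measurable_fun (`]0%R, +oo[%classic : set R) F.
Proof.
move=> [F0 ndF] mD; apply: (measurability _ (ErealGenOInfty.measurableE R)) => //.
move=> _ [_ [c ->] <-]; apply: is_interval_measurable => x y /=.
rewrite !in_itv/= !andbT => -[x0 cx] [y0 cy] z /andP[xz zy].
have z0 : (0 < z)%R by exact: lt_le_trans xz.
by rewrite !in_itv/= z0 !andbT; split=> //; exact: lt_le_trans (ndF _ _ x0 xz).
Qed.

Context d (T : measurableType d) (m : {measure set T -> \bar R}).
Variables (i : T -> R) (delta : T -> \bar R) (w : R -> R) (al : R).
Hypothesis mi : measurable_fun setT i.
Hypothesis mdelta : measurable_fun (i @^-1` `]0%R, +oo[) delta.
Hypothesis delta0 : forall x, (0 < i x)%R -> 0 <= delta x.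
Hypothesis tw : tail_function w.
Hypothesis al0 : (0 < al)%R.
Hypothesis delta_mass : forall x y, (0 < x)%R -> (x <= y)%R ->
  \int[m]_(z in i @^-1` `]x, y]) delta z = (w x `^ al - w y `^ al)%:E.

Let mpre x y : measurable (i @^-1` `]x, y]).
Proof. by rewrite -[X in measurable X]setTI; apply: mi => //; exact: measurable_itv. Qed.

Let mpre_pos : measurable (i @^-1` `]0%R, +oo[).
Proof. by rewrite -[X in measurable X]setTI; apply: mi => //; exact: measurable_itv. Qed.

Let pre_sub x y : (0 <= x)%R -> i @^-1` `]x, y] `<=` i @^-1` `]0%R, +oo[.
Proof.
move=> x0 z /=; rewrite !in_itv/= andbT => /andP[xz _].
exact: le_lt_trans xz.
Qed.

Section fixed_integrand.
Variables (F : R -> \bar R) (b : R).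
Hypotheses (Fp : nondecreasing_pos F) (b1 : (1 < b)%R).

Let mF : measurable_fun (i @^-1` `]0%R, +oo[) (fun x => F (i x)).
Proof.
apply: (@measurable_comp _ _ _ _ _ _ (`]0%R, +oo[%classic : set R)) => //.
- by move=> _ [x xi <-].
- exact: nondecreasing_pos_measurable.
- exact: measurable_funS mi.
Qed.

Let mFd : measurable_fun (i @^-1` `]0%R, +oo[) (fun x => F (i x) * delta x).
Proof. exact: emeasurable_funM. Qed.

Let Fd0 x : (i @^-1` `]0%R, +oo[) x -> 0 <= F (i x) * delta x.
Proof.
rewrite /= in_itv/= andbT => ix; rewrite mule_ge0 ?delta0//.
exact: Fp.1.
Qed.

Let b0 : (0 < b)%R. Proof. exact: lt_trans b1. Qed.

Let ratio_lt1 : (b `^ (- al) < 1)%R.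
Proof.
rewrite powRN invf_lt1 ?powR_gt0//.
have := @gt0_ltr_powR _ _ al0 1%R b; rewrite powR1; apply => //.
  by rewrite nnegrE.
by rewrite nnegrE ltW.
Qed.

Let slice_ge x y : (0 < x)%R -> (x <= y)%R ->
  F x * (w x `^ al - w y `^ al)%:E <= \int[m]_(z in i @^-1` `]x, y]) (F (i z) * delta z).
Proof.
move=> x0 xy; have xsub := @pre_sub x y (ltW x0).
rewrite -delta_mass// -ge0_integralZl//; last 3 first.
- exact: measurable_funS mdelta.
- by move=> z /xsub; rewrite /= in_itv/= andbT => /delta0.
- exact: Fp.1.
apply: ge0_le_integral => //.
- by move=> z /xsub; rewrite /= in_itv/= andbT => iz; rewrite mule_ge0 ?delta0 ?Fp.1.
- by apply: emeasurable_funM => //; exact: measurable_funS mdelta.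
- exact: measurable_funS mFd.
- move=> z /[dup] /xsub; rewrite /= !in_itv/= andbT => iz /andP[xz _].
  by rewrite lee_wpmul2r ?delta0// Fp.2// ltW.
Qed.

Let slice_le x y : (0 < x)%R -> (x <= y)%R ->
  \int[m]_(z in i @^-1` `]x, y]) (F (i z) * delta z) <= F y * (w x `^ al - w y `^ al)%:E.
Proof.
move=> x0 xy; have xsub := @pre_sub x y (ltW x0).
have y0 := lt_le_trans x0 xy.
rewrite -delta_mass// -ge0_integralZl//; last 3 first.
- exact: measurable_funS mdelta.
- by move=> z /xsub; rewrite /= in_itv/= andbT => /delta0.
- exact: Fp.1.
apply: ge0_le_integral => //.
- by move=> z /xsub; rewrite /= in_itv/= andbT => iz; rewrite mule_ge0 ?delta0 ?Fp.1.
- exact: measurable_funS mFd.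
- by apply: emeasurable_funM => //; exact: measurable_funS mdelta.
- move=> z /[dup] /xsub; rewrite /= !in_itv/= andbT => iz /andP[_ zy].
  by rewrite lee_wpmul2r ?delta0// Fp.2.
Qed.

Let sum_slices t K : (0 < t 0%N)%R -> (forall m n, (m <= n)%N -> (t m <= t n)%R) ->
  \int[m]_(z in i @^-1` `]t 0%N, t K]) (F (i z) * delta z) =
  \sum_(k < K) \int[m]_(z in i @^-1` `]t k, t k.+1]) (F (i z) * delta z).
Proof.
move=> t0 ndt; elim: K => [|K IH].
  rewrite big_ord0 (_ : i @^-1` _ = set0) ?integral_set0//.
  by apply/seteqP; split=> // z /=; rewrite in_itv/= ltNge => /andP[/negP].
rewrite big_ord_recr/= -IH -ge0_integral_setU//.
- congr integral; apply/seteqP; split=> z /=; rewrite !in_itv/=.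
    move=> /andP[tz zt]; have [ztK|tKz] := leP (i z) (t K).
      by left; rewrite tz.
    by right.
  move=> [|] /andP[tz zt]; apply/andP; split => //.
    exact: le_trans zt (ndt _ _ _).
  exact: le_lt_trans (ndt _ _ _) tz.
- apply: measurable_funS mFd => // z []; apply: pre_sub; first exact: ltW.
  by rewrite ltW// (lt_le_trans t0)// ndt.
- move=> z zU; apply: Fd0; move: zU => []; apply: pre_sub; first exact: ltW.
  by rewrite ltW// (lt_le_trans t0)// ndt.
- apply/disj_setPS => z [] /=; rewrite !in_itv/= => /andP[_ zt] /andP[tz _].
  by move: (lt_le_trans tz zt); rewrite ltxx.
Qed.

(** On []t k, t k.+1]] the integrand is at least [F (t k)], and the mass of this slice is the
    fraction [1 - b ^ (- al)] of [w (t k) ^ al]. *)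
Lemma integral_tail_lower t K : geometric_seq w b t ->
  \sum_(k < K) F (t k) * (w (t k) `^ al)%:E <=
  ((1 - b `^ (- al))^-1)%:E *
    \int[m]_(z in i @^-1` `]0%R, +oo[) (F (i z) * delta z).
Proof.
move=> gt; have [t0 ndt _] := gt; have tk0 k := geometric_seq_gt0 _ _ _ k gt.
have c0 : (0 < 1 - b `^ (- al))%R by rewrite subr_gt0.
rewrite lee_pdivlMl// ge0_sume_distrr; last first.
  by move=> k _; rewrite mule_ge0 ?lee_fin ?powR_ge0// Fp.1.
apply: (@le_trans _ _ (\int[m]_(z in i @^-1` `]t 0%N, t K]) (F (i z) * delta z))).
  rewrite sum_slices//; apply: lee_sum => k _.
  apply: le_trans (slice_ge _ _ (tk0 k) (ndt _ _ (leqnSn k))).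
  rewrite (geometric_seq_powR _ _ _ al k tw b1 gt) muleCA -EFinM.
  by rewrite mulrBl mul1r.
by apply: ge0_subset_integral => //; exact/pre_sub/ltW.
Qed.

Lemma integral_tail_upper M : (forall t K, geometric_seq w b t ->
    \sum_(k < K) F (t k) * (w (t k) `^ al)%:E <= M) ->
  \int[m]_(z in i @^-1` `]0%R, +oo[) (F (i z) * delta z) <= (b `^ al)%:E * M.
Proof.
move=> hM; pose D n := i @^-1` `](n.+1%:R^-1)%R, (n.+1%:R)%R].
have s0 n : (0 < n.+1%:R^-1 :> R)%R by rewrite invr_gt0.
have -> : i @^-1` `]0%R, +oo[ = \bigcup_n D n.
  apply/seteqP; split=> [x|x [n _]]; last exact/pre_sub/ltW.
  rewrite /= in_itv/= andbT => ix.
  have [k _ kc] := near_infty_natSinv_lt (PosNum ix).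
  exists (maxn k (Num.truncn (i x))) => //; rewrite /D /= in_itv/=; apply/andP; split.
    by apply: (kc (maxn k _)); exact: leq_maxl.
  by rewrite (le_trans (ltW (truncnS_gt _)))// ler_nat ltnS leq_maxr.
apply: (cvge_ub (fun n => \int[m]_(z in D n) (F (i z) * delta z))).
  apply: ge0_nondecreasing_set_cvg_integral => //.
  - move=> p q pq; apply/subsetPset => z; rewrite /D /= !in_itv/= => /andP[pz zp].
    apply/andP; split.
      by apply: le_lt_trans pz; rewrite lef_pV2 ?posrE// ler_nat.
    by rewrite (le_trans zp)// ler_nat.
  - by move=> n; exact: mpre.
  - by move=> n; apply: measurable_funS mFd => //; exact/pre_sub/ltW.
  - by move=> n x /(pre_sub _ _ (ltW (s0 n)))/Fd0.
move=> n; have [t gt tn] := exists_geometric_seq _ _ _ tw b1 (s0 n).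
have [K nK] := geometric_seq_unbounded _ _ _ n.+1%:R tw b1 gt.
have [t0 ndt _] := gt; have tk0 k := geometric_seq_gt0 _ _ _ k gt.
apply: (@le_trans _ _ (\int[m]_(z in i @^-1` `]t 0%N, t K]) (F (i z) * delta z))).
  apply: ge0_subset_integral => //; first exact: mpre.
  - by apply: measurable_funS mFd => //; exact/pre_sub/ltW.
  - by move=> x /(pre_sub _ _ (ltW t0))/Fd0.
  - move=> z; rewrite /D /= !in_itv/= tn => /andP[-> zn]/=.
    exact: le_trans nK.
rewrite sum_slices//.
(* On a slice [F] is bounded by its value at the right end, so the bound [w (t k) ^ al] for the mass
   is rewritten as [b ^ al * w (t k.+1) ^ al]; this shifts the index, and the term of index 0 is
   added for free. *)
apply: (@le_trans _ _ ((b `^ al)%:E * \sum_(k < K.+1) F (t k) * (w (t k) `^ al)%:E)).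
  rewrite big_ord_recl/= ge0_muleDr; last 2 first.
  - by rewrite mule_ge0 ?lee_fin ?powR_ge0// Fp.1.
  - by apply: sume_ge0 => k _; rewrite mule_ge0 ?lee_fin ?powR_ge0// Fp.1.
  rewrite -[leLHS]add0e leeD//.
    by rewrite !mule_ge0 ?lee_fin ?powR_ge0// Fp.1.
  rewrite ge0_sume_distrr; last first.
    by move=> k _; rewrite mule_ge0 ?lee_fin ?powR_ge0// Fp.1.
  apply: lee_sum => k _; apply: le_trans (slice_le _ _ (tk0 k) (ndt _ _ (leqnSn k))) _.
  rewrite muleCA lee_wpmul2l ?Fp.1// -EFinM lee_fin.
  rewrite /bump/= add1n (geometric_seq_powR _ _ _ al k tw b1 gt).
  rewrite [leRHS]mulrA powRN mulfV ?gt_eqF ?powR_gt0// mul1r gerDl oppr_le0.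
  by rewrite mulr_ge0 ?powR_ge0// invr_ge0 powR_ge0.
by rewrite lee_wpmul2l ?lee_fin ?powR_ge0// hM.
Qed.

End fixed_integrand.

(** The map [i] separates the measurable space of integration from the Borel line: it is the
    identity both for the completed Lebesgue measure with density [omega2 ^ theta2] and for a
    Stieltjes measure with density 1. *)
Lemma integral_tail_functional : tail_functional w al
  (fun F => \int[m]_(z in i @^-1` `]0%R, +oo[) (F (i z) * delta z)).
Proof.
move=> b F b1 Fp; split=> [t K|M hM]; first exact: integral_tail_lower.
exact: integral_tail_upper.
Qed.

End line_functional.

(** * The [p -> q] norm as a function of the set *)

Section arrow_norm_sets.
Context d (T : measurableType d) (R : realType) (mu : {measure set T -> \bar R}).
Variables (p q : R).
Hypotheses (p0 : (0 < p)%R) (q0 : (0 < q)%R) (qp : (q <= p)%R).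
Implicit Types (S : set T) (f g u : T -> \bar R).

Local Notation Psi u S := ('N[mu]_(arrow p%:E q%:E)[u \_ S]).

Let le_mul_addeps (x a b : R) : (0 <= a)%R -> (0 <= b)%R ->
  (forall e, (0 < e)%R -> (x <= (a + e) * (b + e))%R) -> (x <= a * b)%R.
Proof.
move=> a0 b0 h; rewrite leNgt; apply/negP => abx.
(* As [e <= 1], [(a + e) * (b + e) <= a * b + e * (a + b + 1)], which is less than [x] by the choice
   of the second bound. *)
pose e := Num.min 1%R ((x - a * b) / (a + b + 2))%R.
have ab2 : (0 < a + b + 2)%R by lra.
have e0 : (0 < e)%R by rewrite lt_min ltr01 divr_gt0// subr_gt0.
have e1 : (e <= 1)%R by rewrite ge_min lexx.
have e2 : (e * (a + b + 2) <= x - a * b)%R by rewrite -ler_pdivlMr// ge_min lexx orbT.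
have := h e e0; nra.
Qed.

(** The norms themselves may vanish, so the estimate with positive bounds is applied to the norms
    increased by [e], and [e] tends to 0. *)
Lemma arrow_norm_hoelder_pow S f u : measurable S ->
  measurable_fun S f -> measurable_fun S u ->
  (forall x, 0 <= f x) -> (forall x, 0 <= u x) ->
  \int[mu]_(x in S) (f x `^ p) < +oo -> Psi u S < +oo ->
  \int[mu]_(x in S) ((f x * u x) `^ q) <=
    2%:E * ((\int[mu]_(x in S) (f x `^ p)) `^ p^-1 * Psi u S) `^ q.
Proof.
move=> mS mf mu_ f0 u0 fy uy.
have I0 : 0 <= \int[mu]_(x in S) (f x `^ p).
  by apply: integral_ge0 => x _; exact: poweR_ge0.
set G := \int[mu]_(x in S) _ in fy I0 *.
have Gy : G `^ p^-1 < +oo by exact: poweR_lty.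
have Gfin : G `^ p^-1 \is a fin_num by rewrite ge0_fin_numE// poweR_ge0.
have ufin : Psi u S \is a fin_num by rewrite ge0_fin_numE// Lnorm_ge0.
set a := fine (G `^ p^-1); set b := fine (Psi u S).
have a0 : (0 <= a)%R by rewrite fine_ge0// poweR_ge0.
have b0 : (0 <= b)%R by rewrite fine_ge0// Lnorm_ge0.
have h (e : R) : (0 < e)%R ->
    \int[mu]_(x in S) ((f x * u x) `^ q) <= (2 * ((a + e) * (b + e)) `^ q)%:E.
  move=> e0; apply: (@arrow_norm_hoelder _ _ _ mu p q) => //.
  - by rewrite ltr_wpDl.
  - by rewrite ltr_wpDl.
  - rewrite -/G -poweR_EFin -[leLHS](@poweRVK _ p) ?gt_eqF// le_poweR ?(ltW p0) ?poweR_ge0//.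
    by rewrite -(fineK Gfin) lee_fin lerDl ltW.
  - by rewrite -(fineK ufin) lee_fin lerDl ltW.
have J0 : 0 <= \int[mu]_(x in S) ((f x * u x) `^ q).
  by apply: integral_ge0 => x _; exact: poweR_ge0.
have : \int[mu]_(x in S) ((f x * u x) `^ q) \is a fin_num.
  by rewrite ge0_fin_numE// (le_lt_trans (h 1%R ltr01))// ltry.
move: J0 h; case: (\int[mu]_(x in S) ((f x * u x) `^ q)) => // x; rewrite lee_fin => x0 h _.
rewrite -(fineK Gfin) -(fineK ufin) -/a -/b -(EFinM a b) poweR_EFin -EFinM lee_fin.
have x20 : (0 <= x / 2)%R by rewrite divr_ge0.
rewrite -ler_pdivrMl// mulrC.
have -> : (x / 2 = ((x / 2) `^ q^-1) `^ q)%R by rewrite -powRrM mulVf ?gt_eqF// powRr1.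
apply: ge0_ler_powR; rewrite ?nnegrE ?powR_ge0 ?mulr_ge0 ?(ltW q0)//.
apply: le_mul_addeps => // e e0.
have xe : (x / 2 <= ((a + e) * (b + e)) `^ q)%R.
  by rewrite ler_pdivrMr// mulrC -lee_fin; exact: h.
have ae : (0 <= (a + e) * (b + e))%R by rewrite mulr_ge0// addr_ge0// ltW.
have qV : (0 <= q^-1)%R by rewrite invr_ge0 ltW.
have := ge0_ler_powR qV _ _ xe; rewrite -[X in (_ <= X)%R]powRrM mulfV ?gt_eqF//.
by rewrite powRr1//; apply; rewrite nnegrE// powR_ge0.
Qed.

Let s := ((q^-1 - p^-1)^-1)%R.

Let s_gt0 : (q < p)%R -> (0 < s)%R.
Proof. by move=> ltqp; rewrite invr_gt0 subr_gt0 ltf_pV2. Qed.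

Let Psi_powE S u : (q < p)%R -> (forall x, 0 <= u x) ->
  Psi u S = (\int[mu]_(x in S) (u x `^ s)) `^ s^-1.
Proof.
move=> ltqp u0; rewrite arrow_lt// Lnorm_restrictE; last by rewrite gt_eqF// s_gt0.
by under eq_integral do rewrite gee0_abs//.
Qed.

Lemma le_arrow_norm S S' u : measurable S -> measurable S' ->
  measurable_fun setT u -> (forall x, 0 <= u x) ->
  S `<=` S' -> Psi u S <= Psi u S'.
Proof.
move=> mS mS' mu_ u0 SS'; move: qp; rewrite le_eqVlt => /predU1P[->|ltqp].
  by rewrite arrow_pp; exact: le_Lnorm_pinfty_restrict.
rewrite !Psi_powE//; apply: le_poweR; first by rewrite invr_ge0 ltW// s_gt0.
  by apply: integral_ge0 => x _; exact: poweR_ge0.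
apply: ge0_subset_integral => //; last by move=> x _; exact: poweR_ge0.
by apply: measurable_poweR_comp; exact: measurable_funS mu_.
Qed.

(** For [q < p] the s-th powers of the norms add over disjoint sets; the factor comes from taking
    the s-th root of the sum, where [s^-1 = q^-1 - p^-1]. For [q = p] it equals 1. *)
Lemma arrow_norm_setU_le S S' u : measurable S -> measurable S' ->
  measurable_fun setT u -> (forall x, 0 <= u x) -> [disjoint S & S'] ->
  Psi u (S `|` S') <= (2 `^ (q^-1 - p^-1))%:E * (Psi u S + Psi u S').
Proof.
move=> mS mS' mu_ u0 SS'; move: qp; rewrite le_eqVlt => /predU1P[qEp|ltqp].
  have -> : arrow p%:E q%:E = +oo by rewrite qEp arrow_pp.
  rewrite qEp subrr powRr0 mul1e.
  apply/Lnorm_pinfty_restrict_le; first by rewrite adde_ge0 ?Lnorm_ge0.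
  have /Lnorm_pinfty_restrict_le := lexx ('N[mu]_+oo[u \_ S]).
  move=> /(_ (Lnorm_ge0 _ _ _)) uS.
  have /Lnorm_pinfty_restrict_le := lexx ('N[mu]_+oo[u \_ S']).
  move=> /(_ (Lnorm_ge0 _ _ _)) uS'.
  apply: filterS2 uS uS' => x uS uS' [/uS|/uS'] h; apply: (le_trans h).
    by rewrite leeDl// Lnorm_ge0.
  by rewrite leeDr// Lnorm_ge0.
rewrite !Psi_powE//.
have mus S'' : measurable_fun S'' (fun x => u x `^ s).
  by apply: measurable_poweR_comp; exact: measurable_funS mu_.
rewrite ge0_integral_setU//; last by move=> x _; exact: poweR_ge0.
rewrite -[(q^-1 - p^-1)%R]invrK -/s.
apply: poweRD_le; first by rewrite invr_ge0 ltW// s_gt0.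
- by apply: integral_ge0 => x _; exact: poweR_ge0.
- by apply: integral_ge0 => x _; exact: poweR_ge0.
Qed.

Section shells.
Variables (B : R -> set T) (t : nat -> R).
Hypothesis mB : forall t, measurable (B t).
Hypothesis ndB : forall s t, (s <= t)%R -> B s `<=` B t.
Hypothesis ndt : forall m n, (m <= n)%N -> (t m <= t n)%R.

(** Shell 0 is the whole first ball, so that the shells up to index [K] partition [B (t K)]. *)
Definition shell k := if k is k'.+1 then B (t k) `\` B (t k') else B (t 0%N).

Lemma measurable_shell k : measurable (shell k).
Proof. by case: k => [|k] /=; [exact: mB|exact: measurableD]. Qed.

Lemma shell_subset k : shell k `<=` B (t k).
Proof. by case: k => [|k] x //= []. Qed.

Lemma setU_shellS k : B (t k.+1) = B (t k) `|` shell k.+1.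
Proof. by rewrite /= setDUK//; apply/ndB/ndt. Qed.

Lemma disjoint_shellS k : [disjoint B (t k) & shell k.+1].
Proof. by apply/disj_setPS => x [xB []]. Qed.

Lemma integral_shellS f k : measurable_fun setT f -> (forall x, 0 <= f x) ->
  \int[mu]_(x in B (t k.+1)) f x =
  \int[mu]_(x in B (t k)) f x + \int[mu]_(x in shell k.+1) f x.
Proof.
move=> mf f0; rewrite setU_shellS ge0_integral_setU//.
- exact: (measurable_shell k.+1).
- exact: measurable_funS mf.
- exact: disjoint_shellS.
Qed.

Lemma sum_integral_shell f K : measurable_fun setT f -> (forall x, 0 <= f x) ->
  \sum_(k < K.+1) \int[mu]_(x in shell k) f x = \int[mu]_(x in B (t K)) f x.
Proof.
move=> mf f0; elim: K => [|K IH]; first by rewrite big_ord1.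
by rewrite big_ord_recr/= IH integral_shellS.
Qed.

End shells.

End arrow_norm_sets.

(** * The Hardy inequality: sufficiency *)

Section hardy.
Context d (T : measurableType d) (R : realType) (mu : {measure set T -> \bar R}).
Variables (p q th : R).
Hypotheses (p0 : (0 < p)%R) (q0 : (0 < q)%R) (qp : (q <= p)%R) (th0 : (0 < th)%R).
Variable B : R -> set T.
Hypothesis mB : forall t, measurable (B t).
Hypothesis ndB : forall s t, (s <= t)%R -> B s `<=` B t.
Variable u : T -> \bar R.
Hypothesis mu_ : measurable_fun setT u.
Hypothesis u0 : forall x, 0 <= u x.
Variable w : R -> R.
Hypothesis tw : tail_function w.
Variable E : (R -> \bar R) -> \bar R.
Hypothesis tE : tail_functional w 1 E.
Implicit Types (S : set T) (f g : T -> \bar R) (t : nat -> R).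

Local Notation Psi S := ('N[mu]_(arrow p%:E q%:E)[u \_ S]).
Let H g s := \int[mu]_(x in B s) ((g x * u x) `^ q).
Let Q := (th / q)%R.
Let r := ((th^-1 - p^-1)^-1)%R.

Let Q0 : (0 < Q)%R. Proof. by rewrite divr_gt0. Qed.

Let r0 : (th < p)%R -> (0 < r)%R.
Proof. by move=> ltthp; rewrite invr_gt0 subr_gt0 ltf_pV2. Qed.

Let mgu g : measurable_fun setT g -> measurable_fun setT (fun x => (g x * u x) `^ q).
Proof. by move=> mg; apply: measurable_poweR_comp; exact: emeasurable_funM. Qed.

Let gu0 g x : 0 <= (g x * u x) `^ q. Proof. exact: poweR_ge0. Qed.

Let H0 g s : 0 <= H g s. Proof. exact: integral_ge0. Qed.

Lemma nondecreasing_pos_hardy g (a : R) : (0 <= a)%R -> measurable_fun setT g ->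
  nondecreasing_pos (fun s => H g s `^ a).
Proof.
move=> a0 mg; split=> [s _|s s' _ ss']; first exact: poweR_ge0.
apply: le_poweR => //; apply: ge0_subset_integral => //; last exact: ndB.
by apply: measurable_funS (mgu _ mg).
Qed.

Lemma nondecreasing_pos_arrow_norm (a : R) : (0 <= a)%R ->
  nondecreasing_pos (fun s => Psi (B s) `^ a).
Proof.
move=> a0; split=> [s _|s s' _ ss']; first exact: poweR_ge0.
by apply: le_poweR; rewrite ?Lnorm_ge0//; apply: le_arrow_norm => //; exact: ndB.
Qed.

(** Absorption with [C = 2 ^ Q] and [beta = b^-1] requires [2 * 2 ^ Q * b^-1 <= 1]; this base gives
    equality. *)
Definition hardy_base := (2 `^ (Q + 1))%R.

Lemma hardy_base_gt1 : (1 < hardy_base)%R.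
Proof.
have := @gt0_ltr_powR R (Q + 1) _ 1%R 2%R; rewrite powR1; apply.
- by rewrite addr_gt0.
- by rewrite nnegrE.
- by rewrite nnegrE.
- by rewrite ltr1n.
Qed.

(** The embedding of l^p into l^th: each [beta k] is at most [c], so
    [beta k ^ th <= c ^ (th - p) * beta k ^ p], while [D] bounds the other factor. The factor 2
    gives the bound the same form as in [geometric_key_gt]. *)
Lemma geometric_key_le (D c : R) : (p <= th)%R -> (0 < D)%R -> (0 < c)%R ->
  (forall s, (0 < s)%R -> Psi (B s) * (w s `^ th^-1)%:E <= D%:E) ->
  forall b t K (beta : nat -> \bar R), geometric_seq w b t ->
    (forall k, 0 <= beta k) -> \sum_(k < K) beta k `^ p <= (c `^ p)%:E ->
    \sum_(k < K) (beta k * Psi (B (t k))) `^ th * (w (t k) `^ 1)%:E <=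
      (2 * (c * D) `^ th)%:E.
Proof.
move=> pth D0 c0 hD b t K beta gt beta0 hbeta.
have [w0 _ _] := tw.
have betap0 (k : nat) : 0 <= beta k `^ p by exact: poweR_ge0.
have betac (k : 'I_K) : beta k <= c%:E.
  rewrite -(lee_poweR2 p)// ?lee_fin ?(ltW c0)//; apply: le_trans hbeta.
  by rewrite (bigD1 k)//= leeDl// sume_ge0.
apply: (@le_trans _ _ (\sum_(k < K) (D `^ th * c `^ (th - p))%:E * beta k `^ p)).
  apply: lee_sum => k _; have tk := geometric_seq_gt0 _ _ _ k gt.
  have wk : ((w (t k) `^ 1)%:E = ((w (t k) `^ th^-1)%:E) `^ th).
    by rewrite poweR_EFin -powRrM mulVf// gt_eqF.
  rewrite wk -poweRM ?mule_ge0 ?Lnorm_ge0 ?lee_fin ?powR_ge0// -muleA.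
  rewrite poweRM ?mule_ge0 ?Lnorm_ge0 ?lee_fin ?powR_ge0//.
  rewrite muleC EFinM -muleA; apply: lee_pmul; rewrite ?poweR_ge0//.
    by rewrite -(poweR_EFin D) le_poweR ?(ltW th0) ?mule_ge0 ?Lnorm_ge0 ?lee_fin ?powR_ge0// hD.
  have [->|pth'] := eqVneq p th; first by rewrite subrr powRr0 mul1e.
  rewrite -[X in _ `^ X](subrK p th) poweRD; last first.
    by apply: add_neq0_poweRD_def; rewrite subrK gt_eqF.
  by rewrite lee_wpmul2r ?poweR_ge0// -(poweR_EFin c) le_poweR// subr_ge0.
rewrite -ge0_sume_distrr//.
apply: le_trans (lee_wpmul2l _ hbeta) _; first by rewrite lee_fin mulr_ge0 ?powR_ge0.
rewrite -EFinM lee_fin -mulrA -powRD; last by rewrite subrK gt_eqF.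
rewrite subrK powRM ?(ltW c0) ?(ltW D0)// [X in (_ <= 2 * X)%R]mulrC.
by rewrite ler_peMl ?mulr_ge0 ?powR_ge0// ler1n.
Qed.

(** Hoelder's inequality for sequences with [1 / th = 1 / r + 1 / p], in the form of the weighted
    Young inequality: dividing by [D] and [c] makes either sum at most 1, whence the factor 2. *)
Lemma geometric_key_gt (D c b : R) : (th < p)%R -> (0 < D)%R -> (0 < c)%R ->
  (forall t K, geometric_seq w b t ->
    \sum_(k < K) Psi (B (t k)) `^ r * (w (t k) `^ (r / th))%:E <= (D `^ r)%:E) ->
  forall t K (beta : nat -> \bar R), geometric_seq w b t ->
    (forall k, 0 <= beta k) -> \sum_(k < K) beta k `^ p <= (c `^ p)%:E ->
    \sum_(k < K) (beta k * Psi (B (t k))) `^ th * (w (t k) `^ 1)%:E <=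
      (2 * (c * D) `^ th)%:E.
Proof.
move=> ltthp D0 c0 hD t K beta gt beta0 hbeta.
have thrp : (th^-1 = r^-1 + p^-1)%R by rewrite invrK subrK.
have r_gt0 := r0 ltthp.
apply: (@le_trans _ _ (\sum_(k < K) ((c * D) `^ th)%:E *
   ((D `^ (- r))%:E * (Psi (B (t k)) `^ r * (w (t k) `^ (r / th))%:E) +
    (c `^ (- p))%:E * beta k `^ p))).
  apply: lee_sum => k _.
  have wk : ((w (t k) `^ 1)%:E = ((w (t k) `^ th^-1)%:E) `^ th).
    by rewrite poweR_EFin -powRrM mulVf// gt_eqF.
  have wrk : (w (t k) `^ (r / th))%:E = ((w (t k) `^ th^-1)%:E) `^ r.
    by rewrite poweR_EFin -powRrM mulrC.
  rewrite wk wrk -!poweRM ?mule_ge0 ?Lnorm_ge0 ?lee_fin ?powR_ge0// -muleA.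
  by apply: poweRM_weighted_young => //; rewrite ?mule_ge0 ?Lnorm_ge0 ?lee_fin ?powR_ge0.
have X0 (k : nat) : 0 <= Psi (B (t k)) `^ r * (w (t k) `^ (r / th))%:E.
  by rewrite mule_ge0 ?poweR_ge0// lee_fin powR_ge0.
have DX0 (k : nat) : 0 <= (D `^ (- r))%:E * (Psi (B (t k)) `^ r * (w (t k) `^ (r / th))%:E).
  by rewrite mule_ge0// lee_fin powR_ge0.
have Y0 (k : nat) : 0 <= (c `^ (- p))%:E * beta k `^ p.
  by rewrite mule_ge0 ?poweR_ge0// lee_fin powR_ge0.
rewrite -ge0_sume_distrr => [|k _]; last by rewrite adde_ge0.
rewrite big_split/= -!ge0_sume_distrr//; last by move=> k _; exact: poweR_ge0.
rewrite (mulrC 2%R) [leRHS]EFinM lee_wpmul2l ?lee_fin ?powR_ge0//.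
rewrite (_ : 2%R = D `^ (- r) * D `^ r + c `^ (- p) * c `^ p)%R; last first.
  by rewrite !powRN !mulVf ?gt_eqF ?powR_gt0.
rewrite EFinD !EFinM leeD// lee_wpmul2l ?lee_fin ?powR_ge0//; exact: hD.
Qed.

(** In this order the factors come from comparing [E] with geometric sums, from absorption, from
    Hoelder's factor 2 raised to the power [Q], and from the inequality for sequences. *)
Definition hardy_const := (hardy_base * (2 * 2 `^ Q) * 2 `^ Q * 2)%R.

(** The two ranges of [th] differ only in the inequality for sequences, which is therefore a
    hypothesis; its [beta k] stands for the p-norm of [g] on the k-th shell. *)
Lemma hardy_sufficient (D c : R) g : (0 < D)%R -> (0 < c)%R ->
  (forall s, (0 < s)%R -> Psi (B s) < +oo) ->
  (forall t K (beta : nat -> \bar R), geometric_seq w hardy_base t ->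
    (forall k, 0 <= beta k) -> \sum_(k < K) beta k `^ p <= (c `^ p)%:E ->
    \sum_(k < K) (beta k * Psi (B (t k))) `^ th * (w (t k) `^ 1)%:E <=
      (2 * (c * D) `^ th)%:E) ->
  measurable_fun setT g -> (forall x, 0 <= g x) ->
  \int[mu]_x (g x `^ p) <= (c `^ p)%:E ->
  E (fun s => H g s `^ Q) <= (hardy_const * (c * D) `^ th)%:E.
Proof.
move=> D0 c0 Psiy key mg g0 gc.
have gp0 x : 0 <= g x `^ p by exact: poweR_ge0.
have mgp : measurable_fun setT (fun x => g x `^ p) by exact: measurable_poweR_comp.
have b1 := hardy_base_gt1.
have b0 : (0 < hardy_base)%R by exact: lt_trans b1.
have [_ upper] := tE _ _ b1 (nondecreasing_pos_hardy _ _ (ltW Q0) mg).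
apply: (@le_trans _ _ ((hardy_base `^ 1)%:E *
  ((2 * 2 `^ Q) * 2 `^ Q * 2 * (c * D) `^ th)%:E)); last first.
  by rewrite powRr1 ?(ltW b0)// -EFinM lee_fin /hardy_const !mulrA.
apply: upper => t K gt; have [t0 ndt _] := gt.
pose sh := @shell _ T R B t.
have msh k : measurable (sh k) by exact: measurable_shell.
have term0 (A : nat -> \bar R) k : 0 <= A k -> 0 <= A k `^ Q * (w (t k) `^ 1)%:E.
  by move=> _; rewrite mule_ge0 ?poweR_ge0// lee_fin powR_ge0.
(* One more term makes the sum nonempty, as absorption and the partition into shells require. *)
apply: (@le_trans _ _ (\sum_(k < K.+1) H g (t k) `^ Q * (w (t k) `^ 1)%:E)).
  by rewrite big_ord_recr/= leeDl// mule_ge0 ?poweR_ge0// lee_fin powR_ge0.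
pose a k := \int[mu]_(x in sh k) ((g x * u x) `^ q).
have a0 k : 0 <= a k by exact: integral_ge0.
apply: (@le_trans _ _ ((2 * 2 `^ Q)%:E * \sum_(k < K.+1) a k `^ Q * (w (t k) `^ 1)%:E)).
  apply: (@sum_geometric_absorb R (fun k => H g (t k) `^ Q) (fun k => a k `^ Q)
    (fun k => w (t k) `^ 1)%R _ (hardy_base `^ (- 1))%R).
  - by move=> k; exact: poweR_ge0.
  - by move=> k; exact: poweR_ge0.
  - by move=> k; exact: powR_ge0.
  - exact: powR_ge0.
  - exact: powR_ge0.
  - rewrite powR_inv1 ?(ltW b0)// /hardy_base powRD; last by apply/implyP.
    by rewrite powRr1// mulrC (mulrC 2%R) mulVf// mulf_neq0// gt_eqF// powR_gt0.
  - rewrite -[leLHS]mul1e lee_wpmul2r ?poweR_ge0// lee_fin.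
    have : (2 `^ 0 <= 2 `^ Q :> R)%R by apply: ler_powR; rewrite ?ler1n// ltW.
    by rewrite powRr0.
  - move=> k; rewrite /H (@integral_shellS _ _ _ mu B t) //; last exact: mgu.
    by apply: poweRD_le => //; [exact: ltW|exact: H0|exact: (a0 k.+1)].
  - by move=> k; exact: (geometric_seq_powR _ _ _ _ _ tw b1 gt).
have -> : (2 * 2 `^ Q * 2 `^ Q * 2 * (c * D) `^ th)%:E =
    (2 * 2 `^ Q)%:E * ((2 `^ Q)%:E * (2 * (c * D) `^ th)%:E).
  by rewrite -!EFinM !mulrA.
rewrite lee_wpmul2l ?lee_fin ?mulr_ge0 ?powR_ge0//.
pose beta k := (\int[mu]_(x in sh k) (g x `^ p)) `^ p^-1.
have betap k : beta k `^ p = \int[mu]_(x in sh k) (g x `^ p).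
  by rewrite /beta poweRVK ?gt_eqF// integral_ge0.
(* Hoelder's inequality on each shell, after which the norm of [u] over the shell is enlarged to
   that over the ball, the quantity that [key] controls. *)
apply: (@le_trans _ _ ((2 `^ Q)%:E *
    \sum_(k < K.+1) (beta k * Psi (B (t k))) `^ th * (w (t k) `^ 1)%:E)).
  rewrite ge0_sume_distrr => [|k _]; last by rewrite mule_ge0 ?poweR_ge0// lee_fin powR_ge0.
  apply: lee_sum => k _; rewrite muleA lee_wpmul2r ?lee_fin ?powR_ge0//.
  have Qth : (th = q * Q)%R by rewrite /Q mulrC divfK// gt_eqF.
  rewrite Qth (poweRrM _ q Q) -poweR_EFin -poweRM ?poweR_ge0//.
  apply: le_poweR; [exact: ltW|exact: a0|].
  have tk0 := geometric_seq_gt0 _ _ _ k gt.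
  have shB : sh k `<=` B (t k) by exact: shell_subset.
  have Psi_sh : Psi (sh k) <= Psi (B (t k)) by apply: le_arrow_norm.
  apply: (@le_trans _ _ (2%:E * (beta k * Psi (sh k)) `^ q)).
    apply: arrow_norm_hoelder_pow => //.
    + exact: measurable_funS mg.
    + exact: measurable_funS mu_.
    + apply: le_lt_trans (ltry (c `^ p)%R); apply: le_trans gc.
      by apply: ge0_subset_integral.
    + by apply: le_lt_trans Psi_sh _; exact: Psiy.
  rewrite lee_wpmul2l// le_poweR ?(ltW q0) ?mule_ge0 ?poweR_ge0 ?Lnorm_ge0//.
  by rewrite lee_wpmul2l// poweR_ge0.
rewrite lee_wpmul2l ?lee_fin ?powR_ge0//.
apply: key => //; first by move=> k; exact: poweR_ge0.
under eq_bigr do rewrite betap.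
rewrite (@sum_integral_shell _ _ _ mu B t)//.
by apply: le_trans gc; apply: ge0_subset_integral.
Qed.

End hardy.

(** * The Hardy inequality: necessity *)

Section hardy_necessity.
Context d (T : measurableType d) (R : realType) (mu : {measure set T -> \bar R}).
Hypothesis mu_sigma_finite : sigma_finite setT mu.
Variables (p q th : R).
Hypotheses (p0 : (0 < p)%R) (q0 : (0 < q)%R) (qp : (q <= p)%R) (th0 : (0 < th)%R).
Variable B : R -> set T.
Hypothesis mB : forall t, measurable (B t).
Hypothesis ndB : forall s t, (s <= t)%R -> B s `<=` B t.
Variable u : T -> \bar R.
Hypothesis mu_ : measurable_fun setT u.
Hypothesis u0 : forall x, 0 <= u x.
Implicit Types (S : set T) (f g : T -> \bar R) (t : nat -> R).

Local Notation Psi S := ('N[mu]_(arrow p%:E q%:E)[u \_ S]).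
Let H g s := \int[mu]_(x in B s) ((g x * u x) `^ q).
Let Q := (th / q)%R.
Let r := ((th^-1 - p^-1)^-1)%R.

Lemma lee_lt_real (x : \bar R) (y : R) : (0 <= y)%R ->
  (forall a : R, (0 <= a)%R -> a%:E < x -> (a <= y)%R) -> x <= y%:E.
Proof.
move=> y0 h; rewrite leNgt; apply/negP; case: x h => [x||] h //.
  rewrite lte_fin => yx.
  have := h ((x + y) / 2)%R; rewrite lte_fin; lra.
by move=> _; have := h (y + 1)%R; rewrite ltry; lra.
Qed.

Lemma integral_supported S g : (forall x, ~ S x -> g x = 0) ->
  \int[mu]_x (g x `^ p) = \int[mu]_(x in S) (g x `^ p).
Proof.
move=> gS; rewrite [RHS]integral_mkcond; apply: eq_integral => x _.
rewrite /patch; case: ifPn => // /negP xS.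
by rewrite gS ?poweR0r ?gt_eqF// => /mem_set.
Qed.

Let extremal S (l a : R) g := [/\ measurable_fun setT g, forall x, 0 <= g x,
  forall x, ~ S x -> g x = 0, \int[mu]_(x in S) (g x `^ p) <= (l `^ p)%:E &
  ((l * a) `^ q)%:E <= \int[mu]_(x in S) ((g x * u x) `^ q)].

(** The condition is void at [a = 0], where the zero function serves: a shell on which the norm of
    [u] vanishes admits no nonnegative value strictly below that norm. *)
Let exists_extremal S (l a : R) : measurable S -> (0 <= l)%R -> (0 <= a)%R ->
  (0 < a)%R ==> (a%:E < Psi S) -> exists g, extremal S l a g.
Proof.
move=> mS l0 a0 aS.
have [a00|an0] := eqVneq a 0%R.
  exists (cst 0); split=> //.
  - under eq_integral do rewrite /= powR0 ?gt_eqF//.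
    by rewrite integral0 lee_fin powR_ge0.
  - by rewrite a00 mulr0 powR0 ?gt_eqF// integral_ge0// => x _; exact: poweR_ge0.
have {}aS : a%:E < Psi S by apply: (implyP aS); rewrite lt0r an0.
have [g [mg g0 gS gp gq]] := arrow_norm_extremal _ _ _ _ mu_sigma_finite _ _ p0 q0 qp _ _ _ mS mu_ u0 a0 aS.
exists (fun x => l%:E * g x); split.
- by apply: emeasurable_funM.
- by move=> x; rewrite mule_ge0.
- by move=> x /gS ->; rewrite mule0.
- under eq_integral do rewrite poweRM ?lee_fin//.
  rewrite ge0_integralZl ?poweR_ge0//; last 2 first.
  + by apply: measurable_poweR_comp; exact: measurable_funS mg.
  + by move=> x _; exact: poweR_ge0.
  by rewrite -[leRHS]mule1 poweR_EFin lee_wpmul2l// lee_fin powR_ge0.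
- under eq_integral do rewrite -muleA poweRM ?lee_fin ?mule_ge0//.
  rewrite ge0_integralZl ?poweR_ge0//; last 2 first.
  + by apply: measurable_poweR_comp; apply: emeasurable_funM; [exact: measurable_funS mg|exact: measurable_funS mu_].
  + by move=> x _; exact: poweR_ge0.
  by rewrite powRM// EFinM poweR_EFin lee_wpmul2l// lee_fin powR_ge0.
Qed.

(** Each new summand vanishes on the previous ball and the earlier ones vanish outside it, so the
    integrals of the p-th powers add exactly and no previous lower bound is lost. *)
Let glue_extremals t (l a : nat -> R) (gk : nat -> T -> \bar R) :
  (forall m n, (m <= n)%N -> (t m <= t n)%R) ->
  (forall k, extremal (@shell _ T R B t k) (l k) (a k) (gk k)) ->
  forall K, exists g, [/\ measurable_fun setT g, forall x, 0 <= g x,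
    forall x, ~ B (t K) x -> g x = 0,
    \int[mu]_(x in B (t K)) (g x `^ p) <= (\sum_(k < K.+1) l k `^ p)%:E &
    forall k, (k <= K)%N -> ((l k * a k) `^ q)%:E <= H g (t k)].
Proof.
move=> ndt gkP; elim=> [|K [g [mg g0 gB gp gq]]].
  have [mg g0 gS gp gq] := gkP 0%N.
  exists (gk 0%N); split => //; first by rewrite big_ord1.
  by move=> k; rewrite leqn0 => /eqP ->.
have [mh h0 hS hp hq] := gkP K.+1; set h := gk K.+1 in mh h0 hS hp hq.
pose g' x := g x + h x.
have mg' : measurable_fun setT g' by exact: emeasurable_funD.
have g'0 x : 0 <= g' x by rewrite adde_ge0.
have g'B x : B (t K) x -> g' x = g x.
  by move=> Bx; rewrite /g' hS ?adde0//= => -[].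
have g'S x : @shell _ T R B t K.+1 x -> g' x = h x.
  by move=> [Bx nBx]; rewrite /g' gB ?add0e.
have mf f S (v : R) : measurable_fun setT f -> measurable_fun S (fun x => (f x * u x) `^ v).
  move=> mf; apply: measurable_poweR_comp; apply: emeasurable_funM; exact: measurable_funS mf || exact: measurable_funS mu_.
exists g'; split => //.
- move=> x Bx; rewrite /g' gB ?hS ?adde0//.
    by move=> /(shell_subset _ _ _ _ _ K.+1).
  by move=> /(ndB _ _ (ndt _ _ (leqnSn K))).
- rewrite (@integral_shellS _ _ _ mu B t) //; last first.
  + by move=> x; exact: poweR_ge0.
  + exact: measurable_poweR_comp.
  rewrite big_ord_recr/= EFinD leeD//.
    by rewrite (eq_integral (fun x => g x `^ p))// => x /set_mem /g'B ->.
  by rewrite (eq_integral (fun x => h x `^ p))// => x /set_mem /g'S ->.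
- move=> k; rewrite leq_eqVlt ltnS => /predU1P[->|kK].
    apply: (le_trans hq).
    apply: (@le_trans _ _ (\int[mu]_(x in @shell _ T R B t K.+1) ((g' x * u x) `^ q))).
      by rewrite le_eqVlt; apply/orP; left; apply/eqP/eq_integral => x /set_mem /g'S ->.
    apply: ge0_subset_integral => //.
    + exact: (measurable_shell _ _ _ _ _ mB K.+1).
    + exact: mf.
    + by move=> x _; exact: poweR_ge0.
    + exact: (shell_subset _ _ _ _ _ K.+1).
  apply: (le_trans (gq k kK)); apply: ge0_le_integral => //.
  + by move=> x _; exact: poweR_ge0.
  + exact: mf.
  + exact: mf.
  + move=> x _; apply: le_poweR; [exact: ltW|by rewrite mule_ge0|].
    by rewrite lee_wpmul2r// leeDl.
Qed.

Variable w : R -> R.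
Hypothesis tw : tail_function w.
Variable E : (R -> \bar R) -> \bar R.
Hypothesis tE : tail_functional w 1 E.
Variable c : R.
Hypothesis c0 : (0 <= c)%R.
Hypothesis hardy_c : forall g (l : R), measurable_fun setT g ->
  (forall x, 0 <= g x) -> (0 <= l)%R -> \int[mu]_x (g x `^ p) <= (l `^ p)%:E ->
  E (fun s => H g s `^ Q) <= ((c * l) `^ th)%:E.

Let Q0 : (0 < Q)%R. Proof. by rewrite divr_gt0. Qed.

Let ndH g : measurable_fun setT g -> nondecreasing_pos (fun s => H g s `^ Q).
Proof. by move=> mg; apply: nondecreasing_pos_hardy => //; exact: ltW. Qed.

(** A single near-extremal for [B s] suffices: the one-term sum along a sequence starting at [s] is
    bounded through [E], and the ratio 2 gives the factor [(1 - 1 / 2)^-1 = 2]. Besides giving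
    necessity for [p <= th], this makes all norms over balls finite for [th < p]. *)
Lemma arrow_norm_tail_le s : (0 < s)%R ->
  Psi (B s) * (w s `^ th^-1)%:E <= (2 `^ th^-1 * c)%:E.
Proof.
move=> s0; have [w0 _ _] := tw.
have ws0 : (0 < w s `^ th^-1)%R by rewrite powR_gt0 ?w0.
rewrite -lee_pdivlMr// -EFinM; apply: lee_lt_real.
  by rewrite !mulr_ge0 ?powR_ge0// invr_ge0 powR_ge0.
move=> a a0 aPsi.
have b1 : (1 < 2 :> R)%R by rewrite ltr1n.
have [|g [mg g0 gS gp gq]] := exists_extremal _ 1%R a (mB s) ler01 a0.
  exact/implyP.
have [t gt ts] := exists_geometric_seq _ _ _ tw b1 s0.
have [low _] := tE _ _ b1 (ndH _ mg).
have := low t 1%N gt; rewrite big_ord1 ts powRr1 ?(ltW (w0 _ _))// => hE.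
have {hE} : ((a `^ th) * w s)%:E <= (2 * c `^ th)%:E.
  apply: le_trans (le_trans hE _).
    rewrite EFinM lee_wpmul2r ?lee_fin ?(ltW (w0 _ _))//.
    have -> : (th = q * Q)%R by rewrite /Q mulrC divfK// gt_eqF.
    rewrite powRrM -(poweR_EFin (a `^ q)); apply: le_poweR; first exact: ltW.
      by rewrite lee_fin powR_ge0.
    by rewrite mul1r in gq.
  rewrite powR_inv1// (_ : 1 - 2^-1 = 2^-1)%R; last by lra.
  rewrite invrK EFinM lee_wpmul2l ?lee_fin//.
  rewrite -[X in (X `^ _)%R]mulr1; apply: hardy_c => //.
  by rewrite (integral_supported (B s)).
rewrite lee_fin => h.
rewrite ler_pdivlMr//.
have -> : (a * w s `^ th^-1 = (a `^ th * w s) `^ th^-1)%R.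
  by rewrite powRM ?powR_ge0 ?(ltW (w0 _ _))// -powRrM divff ?gt_eqF// powRr1.
have -> : (2 `^ th^-1 * c = (2 * c `^ th) `^ th^-1)%R.
  by rewrite powRM ?powR_ge0// -powRrM divff ?gt_eqF// powRr1.
apply: ge0_ler_powR => //.
- by rewrite invr_ge0 ltW.
- by rewrite nnegrE mulr_ge0 ?powR_ge0 ?(ltW (w0 _ _)).
- by rewrite nnegrE mulr_ge0 ?powR_ge0.
Qed.

Hypothesis thp : (th < p)%R.

Let r_gt0 : (0 < r)%R. Proof. by rewrite invr_gt0 subr_gt0 ltf_pV2. Qed.

(** The constant in [Psi (B (t k.+1)) ^ r <= quasi * (Psi (B (t k)) ^ r + Psi (shell k.+1) ^ r)]:
    the factor of [arrow_norm_setU_le] to the power [r], times that of [poweRD_le]. *)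
Let quasi : R := ((2 `^ (q^-1 - p^-1)) `^ r * 2 `^ r)%R.

(** Chosen so that [b ^ (- (r / th)) = (2 * quasi)^-1], the decay that absorption with the constant
    [quasi] requires. *)
Definition necessity_base : R := ((2 * quasi) `^ (th / r))%R.

Let quasi_ge1 : (1 <= quasi)%R.
Proof.
have pow_ge1 (x a : R) : (1 <= x)%R -> (0 <= a)%R -> (1 <= x `^ a)%R.
  by move=> x1 a0; have := ler_powR x1 a0; rewrite powRr0.
have e0 : (0 <= q^-1 - p^-1)%R by rewrite subr_ge0 lef_pV2.
by rewrite -[leLHS]mulr1 ler_pM ?pow_ge1// ?ler1n ?(ltW r_gt0).
Qed.

Let quasi_ge0 : (0 <= quasi)%R. Proof. exact: le_trans ler01 quasi_ge1. Qed.

Lemma necessity_base_gt1 : (1 < necessity_base)%R.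
Proof.
have := @gt0_ltr_powR R (th / r) _ 1%R (2 * quasi)%R; rewrite powR1; apply.
- by rewrite divr_gt0.
- by rewrite nnegrE.
- by rewrite nnegrE mulr_ge0// quasi_ge0.
- by have := quasi_ge1; lra.
Qed.

(** [2 * quasi] is the cost of passing from balls to shells, [2 ^ th] that of halving the norms to
    get near-extremals, and [(1 - b^-1)^-1] that of comparing [E] with geometric sums. *)
Definition necessity_const : R :=
  (2 * quasi * ((2 `^ th * (1 - necessity_base `^ (-1))^-1) `^ (r / th)))%R.

(* The extremals on the shells are glued with the weights [x k `^ p^-1], which turn both sides of the inequality into powers of the same sum. *)
Lemma arrow_norm_geometric_sum_le t K : geometric_seq w necessity_base t ->
  \sum_(k < K) Psi (B (t k)) `^ r * (w (t k) `^ (r / th))%:E <=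
  (necessity_const * c `^ r)%:E.
Proof.
move=> gt; have [t0 ndt _] := gt; have [w0 _ _] := tw.
have b1 := necessity_base_gt1; set b := necessity_base in gt b1.
have tk0 k : (0 < t k)%R := geometric_seq_gt0 _ _ _ k gt.
have r0 := r_gt0.
have msh k : measurable (@shell _ T R B t k) by exact: measurable_shell.
(* Infinite norms are excluded first, because the argument ends by dividing by a power of a sum
   built from these norms. *)
have Psi_fin k : Psi (@shell _ T R B t k) \is a fin_num.
  rewrite ge0_fin_numE ?Lnorm_ge0//.
  apply: (@le_lt_trans _ _ (Psi (B (t k)))).
    by apply: le_arrow_norm => //; exact: shell_subset.
  have := arrow_norm_tail_le _ (tk0 k); case: (Psi (B (t k))) => [z _|| _]; rewrite ?ltry//.
  by rewrite gt0_mulye ?lte_fin ?powR_gt0 ?w0.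
pose f k := fine (Psi (@shell _ T R B t k)).
have fE k : Psi (@shell _ T R B t k) = (f k)%:E by rewrite /f fineK.
have f0 k : (0 <= f k)%R by rewrite fine_ge0// Lnorm_ge0.
pose x k := (f k `^ r * w (t k) `^ (r / th))%R.
have x0 k : (0 <= x k)%R by rewrite mulr_ge0 ?powR_ge0.
pose e := (\sum_(k < K.+1) x k)%R.
have e0 : (0 <= e)%R by exact: sumr_ge0.
apply: (@le_trans _ _ ((2 * quasi * e)%:E)).
  apply: (@le_trans _ _ (\sum_(k < K.+1) Psi (B (t k)) `^ r * (w (t k) `^ (r / th))%:E)).
    by rewrite big_ord_recr/= leeDl// mule_ge0 ?poweR_ge0// lee_fin powR_ge0.
  apply: (@le_trans _ _ ((2 * quasi)%:E * \sum_(k < K.+1)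
      Psi (@shell _ T R B t k) `^ r * (w (t k) `^ (r / th))%:E)); last first.
    rewrite [leRHS]EFinM lee_wpmul2l ?lee_fin ?mulr_ge0 ?quasi_ge0//.
    by rewrite /e -sumEFin; apply: lee_sum => k _; rewrite fE.
  apply: (@sum_geometric_absorb R (fun k => Psi (B (t k)) `^ r)
    (fun k => Psi (@shell _ T R B t k) `^ r)
    (fun k => w (t k) `^ (r / th))%R _ (b `^ (- (r / th)))%R).
  - by move=> k; exact: poweR_ge0.
  - by move=> k; exact: poweR_ge0.
  - by move=> k; exact: powR_ge0.
  - exact: quasi_ge0.
  - exact: powR_ge0.
  - rewrite /b /necessity_base -powRrM.
    have -> : (th / r * - (r / th) = -1)%R.
      by rewrite mulrN mulrA divfK ?gt_eqF// divff ?gt_eqF.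
    by rewrite powR_inv1 ?mulr_ge0 ?quasi_ge0// mulfV// mulf_neq0// gt_eqF// (lt_le_trans ltr01).
  - by rewrite -[leLHS]mul1e lee_wpmul2r ?poweR_ge0// lee_fin.
  - move=> k; rewrite (@setU_shellS _ T R B t ndB ndt).
    apply: (@le_trans _ _ (((2 `^ (q^-1 - p^-1))%:E *
        (Psi (B (t k)) + Psi (@shell _ T R B t k.+1))) `^ r)).
      apply: le_poweR; rewrite ?Lnorm_ge0 ?(ltW r0)//.
      apply: arrow_norm_setU_le => //; exact: disjoint_shellS.
    rewrite poweRM ?lee_fin ?powR_ge0 ?adde_ge0 ?Lnorm_ge0// poweR_EFin.
    rewrite /quasi EFinM -muleA lee_wpmul2l ?lee_fin ?powR_ge0//.
    by apply: poweRD_le; rewrite ?Lnorm_ge0// ltW.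
  - by move=> k; exact: (geometric_seq_powR _ _ _ _ _ tw b1 gt).
rewrite lee_fin /necessity_const -[leRHS]mulrA.
apply: ler_wpM2l; first by rewrite mulr_ge0 ?quasi_ge0.
pose l k := (x k `^ p^-1)%R.
have ex k : exists g, extremal (@shell _ T R B t k) (l k) (f k / 2)%R g.
  apply: exists_extremal => //; rewrite ?powR_ge0 ?divr_ge0//.
  apply/implyP; rewrite fE lte_fin; have := f0 k; lra.
have /choice[gk gkP] := ex.
have [g [mg g0 gB gp gq]] := glue_extremals _ _ _ _ ndt gkP K.
have sl : (\sum_(k < K.+1) l k `^ p = e)%R.
  by apply: eq_bigr => k _; rewrite /l -powRrM mulVf ?gt_eqF// powRr1.
have hE := hardy_c g (e `^ p^-1)%R mg g0 (powR_ge0 _ _).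
have {}hE : E (fun s => H g s `^ Q) <= ((c * e `^ p^-1) `^ th)%:E.
  apply: hE; rewrite (integral_supported (B (t K)))// -powRrM mulVf ?gt_eqF// powRr1//.
  by rewrite -sl.
have [low _] := tE _ _ b1 (ndH _ mg).
have {}low := low t K.+1 gt.
have b10 : (0 < 1 - b `^ (-1))%R.
  by rewrite subr_gt0 powR_inv1 ?ltW ?(lt_trans ltr01)// invf_lt1 ?(lt_trans ltr01).
pose M := (2 `^ th * (1 - b `^ (-1))^-1)%R.
have M0 : (0 <= M)%R by rewrite mulr_ge0 ?powR_ge0// invr_ge0 ltW.
have thrp : (th^-1 = r^-1 + p^-1)%R by rewrite invrK subrK.
(* With [x k = v ^ r] and [l k = v ^ (r / p)], the identity [r / p + 1 = r / th] turns
   [(l k * f k) ^ th * w (t k)] into [x k] itself. *)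
have term k : (x k * 2 `^ (- th) = (l k * (f k / 2)) `^ th * w (t k))%R.
  pose v := (f k * w (t k) `^ th^-1)%R.
  have v0 : (0 <= v)%R by rewrite mulr_ge0 ?powR_ge0.
  have xv : (x k = v `^ r)%R by rewrite /x /v powRM ?powR_ge0// -powRrM (mulrC th^-1)%R.
  have -> : ((l k * (f k / 2)) `^ th * w (t k) = (l k `^ th * v `^ th) * 2 `^ (- th))%R.
    rewrite !powRM ?powR_ge0 ?mulr_ge0 ?powR_ge0// -!mulrA; congr (_ * _)%R.
    rewrite -(powR_inv1 (ler0n _ 2)) -[((2 `^ -1) `^ th)%R]powRrM mulN1r.
    rewrite -[((w (t k) `^ th^-1) `^ th)%R]powRrM mulVf ?gt_eqF// powRr1 ?(ltW (w0 _ _))//.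
    by congr (_ * _)%R; rewrite mulrC.
  congr (_ * _)%R; rewrite xv /l xv -!powRrM.
  rewrite -powRD; last by rewrite gt_eqF// addr_gt0// !mulr_gt0// invr_gt0.
  congr (_ `^ _)%R.
  transitivity (r * th * th^-1)%R; first by rewrite mulfK// gt_eqF.
  by rewrite thrp; field; rewrite !gt_eqF.
have eM : (e <= M * c `^ th * e `^ (th / p))%R.
  have : (2 `^ (- th) * e <= (1 - b `^ (-1))^-1 * (c * e `^ p^-1) `^ th)%R.
    rewrite -lee_fin [leRHS]EFinM; apply: (le_trans _ (lee_wpmul2l _ hE)); last first.
      by rewrite lee_fin invr_ge0 ltW.
    apply: le_trans low; rewrite /e mulr_sumr -sumEFin; apply: lee_sum => k _.
    rewrite mulrC term EFinM powRr1 ?(ltW (w0 _ _))// lee_wpmul2r ?lee_fin ?(ltW (w0 _ _))//.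
    have -> : (th = q * Q)%R by rewrite /Q mulrC divfK// gt_eqF.
    rewrite powRrM -(poweR_EFin (_ `^ q)%R); apply: le_poweR; first exact: ltW.
      by rewrite lee_fin powR_ge0.
    by apply: gq; rewrite -ltnS.
  rewrite powRN mulrC ler_pdivrMr ?powR_gt0// => /le_trans; apply.
  rewrite powRM ?powR_ge0// -powRrM mulrC /M (mulrC p^-1%R) !mulrA.
  by rewrite (mulrC (2 `^ th)%R) -!mulrA; exact: lexx.
have [e00|en0] := eqVneq e 0%R; first by rewrite e00 mulr_ge0 ?powR_ge0.
have e_gt0 : (0 < e)%R by rewrite lt0r en0.
(* Dividing by [e ^ (th / p)] is allowed because [e] is a finite positive sum; [1 - th / p = th / r]
   is the exponent that remains. *)
have er : (e `^ (th / r) <= M * c `^ th)%R.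
  have := eM; rewrite -ler_pdivrMr ?powR_gt0//; apply: le_trans.
  rewrite -[X in (_ <= X / _)%R](powRr1 e0) -powRB; last by apply/implyP.
  have -> : (1 - th / p = th / r)%R.
    rewrite -[1%R](@divff _ th) ?gt_eqF// -mulrBr; congr (_ * _)%R.
    by rewrite thrp addrK.
  exact: lexx.
have rth0 : (0 <= r / th)%R by rewrite divr_ge0// ltW.
have ce : ((c `^ th) `^ (r / th) = c `^ r)%R by rewrite -powRrM mulrC divfK ?gt_eqF.
have ee : ((e `^ (th / r)) `^ (r / th) = e)%R.
  by rewrite -powRrM mulrA divfK ?gt_eqF// divff ?gt_eqF// powRr1.
rewrite -{1}ee -ce -powRM ?powR_ge0//.
apply: ge0_ler_powR => //; first by rewrite nnegrE powR_ge0.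
by rewrite nnegrE; apply: mulr_ge0; [exact: M0|exact: powR_ge0].
Qed.

End hardy_necessity.

(** * Tails of integrals and Stieltjes measures *)

Section tail_of_integral.
Context {R : realType} d (T : measurableType d) (m : {measure set T -> \bar R}).
Variables (i : T -> R) (delta : T -> \bar R).
Hypothesis mi : measurable_fun setT i.
Hypothesis mdelta : measurable_fun (i @^-1` `]0%R, +oo[) delta.
Hypothesis delta0 : forall x, (0 < i x)%R -> 0 <= delta x.
Hypothesis m_null : forall x, m (i @^-1` [set x]) = 0.
Hypothesis tail_gt0 : forall t, (0 < t)%R ->
  0 < \int[m]_(z in i @^-1` `]t, +oo[) delta z.
Hypothesis tail_lty : forall t, (0 < t)%R ->
  \int[m]_(z in i @^-1` `]t, +oo[) delta z < +oo.

Definition integral_tail t := fine (\int[m]_(z in i @^-1` `]t, +oo[) delta z).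
Local Notation w := integral_tail.

Let mpre (I : interval R) : measurable (i @^-1` [set` I]).
Proof. by rewrite -[X in measurable X]setTI; apply: mi => //; exact: measurable_itv. Qed.

Let wE t : (0 < t)%R -> \int[m]_(z in i @^-1` `]t, +oo[) delta z = (w t)%:E.
Proof.
by move=> t0; rewrite fineK// ge0_fin_numE ?tail_lty// ltW// tail_gt0.
Qed.

Let mdeltaS (D : set T) : (forall z, D z -> (0 < i z)%R) -> measurable_fun D delta.
Proof.
move=> D0; apply: (measurable_funS _ _ mdelta); first exact: mpre.
by move=> z /D0; rewrite /= in_itv/= andbT.
Qed.

Let integral_itvD s t : (0 < s)%R -> (s <= t)%R ->
  \int[m]_(z in i @^-1` `]s, t]) delta z = (w s - w t)%:E.
Proof.
move=> s0 st; have t0 := lt_le_trans s0 st.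
have /esym : \int[m]_(z in i @^-1` `]s, +oo[) delta z =
    \int[m]_(z in i @^-1` `]s, t]) delta z + \int[m]_(z in i @^-1` `]t, +oo[) delta z.
  rewrite -ge0_integral_setU//; try exact: mpre.
  - congr integral; apply/seteqP; split=> z /=; rewrite !in_itv/= !andbT.
      by move=> sz; have [zt|tz] := leP (i z) t; [left; rewrite sz|right].
    by move=> [/andP[]//|tz]; exact: le_lt_trans tz.
  - by apply: mdeltaS => z [] /=; rewrite in_itv/= ?andbT; [move=> /andP[sz _]; exact: lt_trans sz|exact: lt_trans].
  - move=> z zU; apply: delta0; move: zU => [] /=; rewrite in_itv/= ?andbT; [move=> /andP[sz _]; exact: lt_trans sz|exact: lt_trans].
  - apply/disj_setPS => z [] /=; rewrite !in_itv/= andbT => /andP[_ zt] tz.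
    by move: (lt_le_trans tz zt); rewrite ltxx.
rewrite !wE//.
have I0 : 0 <= \int[m]_(z in i @^-1` `]s, t]) delta z.
  by apply: integral_ge0 => z /=; rewrite in_itv/= => /andP[sz _]; apply: delta0; exact: lt_trans sz.
case: (\int[m]_(z in i @^-1` `]s, t]) delta z) I0 => // x _ [<-].
by rewrite addrK.
Qed.

(** The value [y] is attained at the supremum of the points where [w >= y]. Continuity of the
    integral from below gives [w t <= y], and the absence of point masses gives the reverse
    inequality. *)
Lemma integral_tail_tail_function : tail_function w.
Proof.
have w0 s : (0 < s)%R -> (0 < w s)%R.
  by move=> s0; rewrite -lte_fin -wE// tail_gt0.
have ndw s t : (0 < s)%R -> (s <= t)%R -> (w t <= w s)%R.
  move=> s0 st; rewrite -subr_ge0 -lee_fin -integral_itvD//.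
  by apply: integral_ge0 => z /=; rewrite in_itv/= => /andP[sz _]; apply: delta0; exact: lt_trans sz.
split => // s y s0 y0 yws.
have dpos a z : (0 < a)%R -> (a < i z)%R -> 0 <= delta z.
  by move=> a0 az; apply: delta0; exact: lt_trans az.
(* Otherwise every []s, s + k]] would carry mass at most [w s - y], hence so would []s, +oo[], whose
   mass is [w s]. *)
have [N [sN wN]] : exists N, (s <= N)%R /\ (w N < y)%R.
  apply: contrapT => /forallNP h.
  suff : \int[m]_(z in i @^-1` `]s, +oo[) delta z <= (w s - y)%:E.
    by rewrite wE// lee_fin; lra.
  have -> : i @^-1` `]s, +oo[ = \bigcup_k i @^-1` `]s, (s + k%:R)%R].
    apply/seteqP; split=> z /=.
      rewrite in_itv/= andbT => sz; exists (Num.truncn (i z - s)).+1 => //=.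
      by rewrite in_itv/= sz/= addrC -lerBlDr ltW// truncnS_gt.
    by move=> [k _ /=]; rewrite !in_itv/= andbT => /andP[].
  apply: (cvge_ub (fun k => \int[m]_(z in i @^-1` `]s, (s + k%:R)%R]) delta z)).
    apply: ge0_nondecreasing_set_cvg_integral.
    - move=> j k jk; apply/subsetPset => z /=; rewrite !in_itv/= => /andP[-> zj]/=.
      by apply: (le_trans zj); rewrite lerD2l ler_nat.
    - by move=> k; exact: mpre.
    - by move=> k; apply: mdeltaS => z /=; rewrite in_itv/= => /andP[sz _]; exact: lt_trans sz.
    - by move=> k z /=; rewrite in_itv/= => /andP[sz _]; exact: dpos sz.
  move=> k; have sk : (s <= s + k%:R)%R by rewrite lerDl.
  rewrite integral_itvD// lee_fin.
  have := h (s + k%:R)%R; rewrite sk => /not_andP[//|/negP]; rewrite -leNgt; lra.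
pose Z := [set t : R | (s <= t)%R /\ (y <= w t)%R].
have Zs : Z s by split.
have Zub : ubound Z N.
  move=> t [st yt]; rewrite leNgt; apply/negP => Nt.
  have := ndw _ _ (lt_le_trans s0 sN) (ltW Nt); lra.
have supZ : has_sup Z by split; [exists s|exists N].
pose t := sup Z.
have st : (s <= t)%R by exact: (sup_upper_bound supZ).
have t0 := lt_le_trans s0 st.
exists t => //; apply/eqP; rewrite eq_le; apply/andP; split.
  rewrite -lee_fin -wE//.
  have -> : i @^-1` `]t, +oo[ = \bigcup_k i @^-1` `](t + k.+1%:R^-1)%R, +oo[.
    apply/seteqP; split=> z /=.
      rewrite in_itv/= andbT => tz; have tz0 : (0 < i z - t)%R by rewrite subr_gt0.
      have [k _ kc] := near_infty_natSinv_lt (PosNum tz0).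
      exists k => //=; rewrite in_itv/= andbT addrC -ltrBrDr.
      exact: (kc k (leqnn _)).
    move=> [k _ /=]; rewrite !in_itv/= !andbT; apply: le_lt_trans.
    by rewrite lerDl.
  apply: (cvge_ub (fun k => \int[m]_(z in i @^-1` `](t + k.+1%:R^-1)%R, +oo[) delta z)).
    apply: ge0_nondecreasing_set_cvg_integral.
    - move=> j k jk; apply/subsetPset => z /=; rewrite !in_itv/= !andbT.
      by apply: le_lt_trans; rewrite lerD2l lef_pV2 ?posrE// ler_nat.
    - by move=> k; exact: mpre.
    - move=> k; apply: mdeltaS => z /=; rewrite in_itv/= andbT; apply: lt_trans.
      by rewrite addr_gt0.
    - move=> k z /=; rewrite in_itv/= andbT; apply: dpos.
      by rewrite addr_gt0.
  move=> k; have tk : (t < t + k.+1%:R^-1)%R by rewrite ltrDl.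
  rewrite wE ?lee_fin; last exact: lt_trans tk.
  rewrite leNgt; apply/negP => yk.
  have : Z (t + k.+1%:R^-1)%R by split; [rewrite (le_trans st)// ltW|exact: ltW].
  by move=> /(sup_upper_bound supZ); rewrite leNgt tk.
suff : \int[m]_(z in i @^-1` `]s, t]) delta z <= (w s - y)%:E.
  by rewrite integral_itvD// lee_fin; lra.
rewrite (@ge0_negligible_integral _ _ _ m _ (i @^-1` [set t]))//; last 3 first.
- by rewrite -set_itv1; exact: mpre.
- by apply: mdeltaS => z /=; rewrite in_itv/= => /andP[sz _]; exact: lt_trans sz.
- by move=> z /=; rewrite in_itv/= => /andP[sz _]; exact: dpos sz.
have -> : i @^-1` `]s, t] `\` i @^-1` [set t] = \bigcup_k i @^-1` `]s, (t - k.+1%:R^-1)%R].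
  apply/seteqP; split=> z /=.
    rewrite in_itv/= => -[/andP[sz zt] /eqP zNt].
    have tz0 : (0 < t - i z)%R by rewrite subr_gt0 lt_neqAle zNt.
    have [k _ kc] := near_infty_natSinv_lt (PosNum tz0).
    exists k => //=; rewrite in_itv/= sz/= lerBrDr addrC -lerBrDr ltW//.
    exact: (kc k (leqnn _)).
  move=> [k _ /=]; rewrite !in_itv/= => /andP[-> zk].
  have {}zk : (i z < t)%R by rewrite (le_lt_trans zk)// ltrBlDr ltrDl.
  by split; [rewrite ltW|apply/eqP; rewrite lt_eqF].
apply: (cvge_ub (fun k => \int[m]_(z in i @^-1` `]s, (t - k.+1%:R^-1)%R]) delta z)).
  apply: ge0_nondecreasing_set_cvg_integral.
  - move=> j k jk; apply/subsetPset => z /=; rewrite !in_itv/= => /andP[-> zj]/=.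
    by apply: (le_trans zj); rewrite lerD2l lerN2 lef_pV2 ?posrE// ler_nat.
  - by move=> k; exact: mpre.
  - by move=> k; apply: mdeltaS => z /=; rewrite in_itv/= => /andP[sz _]; exact: lt_trans sz.
  - by move=> k z /=; rewrite in_itv/= => /andP[sz _]; exact: dpos sz.
move=> k; have [sk|ks] := leP s (t - k.+1%:R^-1)%R.
  rewrite integral_itvD// lee_fin lerD2l lerN2.
  have tk : (t - k.+1%:R^-1 < t)%R by rewrite ltrBlDr ltrDl.
  have [z [sz yz] tz] := sup_gt supZ.1 tk.
  by apply: (le_trans yz); apply: ndw (ltW tz); exact: lt_le_trans sk.
rewrite (_ : i @^-1` _ = set0) ?integral_set0 ?lee_fin ?subr_ge0//.
apply/seteqP; split=> z //=; rewrite in_itv/= => /andP[sz zk].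
by have := lt_le_trans sz zk; rewrite ltNge (ltW ks).
Qed.

Lemma integral_itv_tail s t : (0 < s)%R -> (s <= t)%R ->
  \int[m]_(z in i @^-1` `]s, t]) delta z = (w s `^ 1 - w t `^ 1)%:E.
Proof.
have [w0 _ _] := integral_tail_tail_function.
move=> s0 st; rewrite integral_itvD// !powRr1// ltW// w0//.
exact: lt_le_trans st.
Qed.

End tail_of_integral.

Section stieltjes.
Context {R : realType}.
Variables (w : R -> R) (al : R) (G : R -> \bar R).
Hypotheses (tw : tail_function w) (al0 : (0 < al)%R).
Hypothesis GE : forall t, (0 < t)%R -> G t = (- (w t `^ al))%:E.

Let g t := (- (w t `^ al))%R.

Let ndg s t : (0 < s)%R -> (s <= t)%R -> (g s <= g t)%R.
Proof.
have [w0 ndw _] := tw.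
move=> s0 st; rewrite lerN2 ge0_ler_powR ?nnegrE ?(ltW al0) ?ndw ?(ltW (w0 _ _))//.
exact: lt_le_trans st.
Qed.

(** A value of [w ^ al] slightly below that at [b] is attained at some [t > b], and monotonicity
    controls everything in between. *)
Let right_modulus b e : (0 < b)%R -> (0 < e)%R ->
  exists2 t, (b < t)%R & forall s, (b <= s)%R -> (s < t)%R -> (`|g b - g s| <= e)%R.
Proof.
have [w0 ndw sw] := tw; move=> b0 e0.
have wb0 := w0 _ b0; have wbal0 : (0 < w b `^ al)%R by rewrite powR_gt0.
(* The half keeps the target value positive, as the intermediate value property requires. *)
pose Y := Num.max (w b `^ al - e)%R (w b `^ al / 2)%R.
have Y0 : (0 < Y)%R by rewrite lt_max divr_gt0// orbT.
have YW : (Y < w b `^ al)%R by rewrite gt_max; apply/andP; split; lra.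
have yw : (Y `^ al^-1 < w b)%R.
  have -> : w b = ((w b `^ al) `^ al^-1)%R by rewrite -powRrM divff ?gt_eqF// powRr1// ltW.
  by rewrite gt0_ltr_powR ?invr_gt0// nnegrE ltW.
have [||t bt wt] := sw b (Y `^ al^-1)%R b0; [by rewrite powR_gt0|exact: ltW|].
have ltbt : (b < t)%R.
  by rewrite lt_neqAle bt andbT; apply/eqP => bE; move: yw; rewrite -wt -bE ltxx.
exists t => // s bs st; have s0 := lt_le_trans b0 bs.
have gbs := ndg _ _ b0 bs; have gst := ndg _ _ s0 (ltW st).
have gt : g t = (- Y)%R by rewrite /g wt -powRrM mulVf ?gt_eqF// powRr1// ltW.
have Ye : (w b `^ al - e <= Y)%R by rewrite le_max lexx.
rewrite distrC ger0_norm ?subr_ge0//.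
rewrite gt in gst; rewrite {1}/g in gbs; rewrite {2}/g; lra.
Qed.

Let lim_right b : (0 < b)%R -> lim (G s @[s --> b^'+]) = (g b)%:E.
Proof.
move=> b0; apply: cvg_lim; first exact: ereal_hausdorff.
apply: (@cvg_trans _ ((g s)%:E @[s --> b^'+])).
  apply: near_eq_cvg; near=> s; rewrite /g GE//.
  by apply: (lt_trans b0); near: s; exact: nbhs_right_gt.
apply: cvg_EFin; first exact: nearW.
apply/cvgrPdist_le => e e0; have [t bt ht] := right_modulus _ _ b0 e0.
near=> s; apply: ht; near: s; [exact: nbhs_right_ge|exact: nbhs_right_lt].
Unshelve. all: by end_near. Qed.

Lemma is_stieltjes_itv (m : {measure set (measurableTypeR R) -> \bar R}) x y :
  is_stieltjes G m -> (0 < x)%R -> (x <= y)%R ->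
  m `]x, y]%classic = (w x `^ al - w y `^ al)%:E.
Proof.
move=> Gm x0 xy; rewrite Gm// !lim_right//; last exact: lt_le_trans xy.
by rewrite -EFinB /g opprK addrC.
Qed.

(* [G] may blow up at 0, so [lebesgue_stieltjes_measure] is used on the whole line and transported by [expR]. *)
Lemma exists_stieltjes : exists m, is_stieltjes G m.
Proof.
pose f y := g (expR y).
have ndf : nondecreasing f.
  by move=> x y xy; apply: ndg; [exact: expR_gt0|rewrite ler_expR].
have rcf : right_continuous f.
  move=> x; apply/cvgrPdist_le => e e0.
  have [t xt ht] := right_modulus _ _ (expR_gt0 x) e0.
  have t0 : (0 < t)%R by exact: lt_trans (expR_gt0 x) xt.
  near=> s; apply: ht; rewrite ?ler_expR.
    by near: s; exact: nbhs_right_ge.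
  rewrite -[t]lnK ?posrE// ltr_expR; near: s; apply: nbhs_right_lt.
  by rewrite -ltr_expR lnK ?posrE.
have [F FE] : exists F : cumulative R R, F = f :> (R -> R).
  pose F0 : cumulative R R := HB.pack f (isCumulative.Build R _ R f ndf rcf).
  by exists F0.
have me : measurable_fun [set: measurableTypeR R] (expR : R -> measurableTypeR R).
  exact: measurable_expR.
exists (measure_function_pushforward__canonical__measure_function_Measure
  (lebesgue_stieltjes_measure F) me).
move=> x y x0 xy; have y0 := lt_le_trans x0 xy.
rewrite !lim_right//= /pushforward.
rewrite (_ : _ @^-1` _ = `]ln x, ln y]%classic); last first.
  apply/seteqP; split=> z /=; rewrite !in_itv/=.
    by rewrite -{1}[x]lnK ?posrE// -{1}[y]lnK ?posrE// ltr_expR ler_expR.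
  by rewrite -{2}[x]lnK ?posrE// -{2}[y]lnK ?posrE// ltr_expR ler_expR.
rewrite /lebesgue_stieltjes_measure /measure_extension/=. rewrite measurable_mu_extE; last exact: is_ocitv.
rewrite /= wlength_itv_bnd; last by rewrite ler_ln ?posrE.
by rewrite FE /f !lnK ?posrE.
Unshelve. all: by end_near. Qed.

(** Existence of a Stieltjes measure rules out the default value [mzero]. *)
Lemma stieltjes_measure_itv x y : (0 < x)%R -> (x <= y)%R ->
  stieltjes_measure G `]x, y]%classic = (w x `^ al - w y `^ al)%:E.
Proof.
apply: is_stieltjes_itv; rewrite /stieltjes_measure.
by case: pselect => [h|/(_ exists_stieltjes)//]; case: cid.
Qed.

End stieltjes.

(** * Lebesgue measure on R^n and on the line *)

Section euclidean_space.
Context {R : realType} {n : nat}.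
Implicit Types (i : 'I_n.+1) (A : set 'rV[R]_n.+1).
Local Notation E := (caratheodory_type (@lebesgue_outer R n)).
Local Notation mu := (@lebesgue_measure_rV R n).

Let cut_lower i c (ab : 'rV[R]_n.+1 * 'rV[R]_n.+1) : 'rV[R]_n.+1 * 'rV[R]_n.+1 :=
  (ab.1, \row_j if j == i then Num.min (ab.2 ord0 j) c else ab.2 ord0 j).

Let cut_upper i c (ab : 'rV[R]_n.+1 * 'rV[R]_n.+1) : 'rV[R]_n.+1 * 'rV[R]_n.+1 :=
  (\row_j if j == i then Num.max (ab.1 ord0 j) c else ab.1 ord0 j, ab.2).

Let box_volume_cut i c ab :
  box_volume (cut_lower i c ab) + box_volume (cut_upper i c ab) = box_volume ab.
Proof.
rewrite /box_volume -EFinD; congr EFin.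
rewrite (bigD1 i)//= [X in (_ + X)%R](bigD1 i)//= [RHS](bigD1 i)//= !mxE !eqxx.
rewrite (eq_bigr (fun j => Num.max 0 (ab.2 ord0 j - ab.1 ord0 j))%R); last first.
  by move=> j /negPf ji; rewrite !mxE ji.
rewrite [X in (_ + _ * X)%R](eq_bigr
    (fun j => Num.max 0 (ab.2 ord0 j - ab.1 ord0 j))%R); last first.
  by move=> j /negPf ji; rewrite !mxE ji.
rewrite -mulrDl; congr (_ * _)%R.
by rewrite /Num.min /Num.max; do !case: ifPn; lra.
Qed.

(** Cutting every box of a cover along the hyperplane yields covers of both parts with the same
    total volume, which is Caratheodory's criterion. *)
Lemma halfspace_measurable i (c : R) :
  measurable ([set x | (x ord0 i <= c)%R] : set E).
Proof.
apply: le_caratheodory_measurable => A.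
set H := [set x | _].
apply: le_ereal_inf_tmp => _ [B AB <-].
apply: (@le_trans _ _ (\sum_(k <oo) box_volume (cut_lower i c (B k)) +
    \sum_(k <oo) box_volume (cut_upper i c (B k)))).
  apply: leeD; apply: ereal_inf_lbound.
    exists (fun k => cut_lower i c (B k)) => // x [Ax Hx].
    have [k _ Bx] := AB x Ax; exists k => // j; rewrite /= !mxE.
    have /andP[l u] := Bx j; rewrite l/=; case: eqP => [->|//].
    by rewrite le_min Hx andbT; have /andP[] := Bx i.
  exists (fun k => cut_upper i c (B k)) => // x [Ax Hx].
  have [k _ Bx] := AB x Ax; exists k => // j; rewrite /= !mxE.
  have /andP[l u] := Bx j; rewrite u andbT; case: eqP => [->|//].
  rewrite gt_max; apply/andP; split; first by have /andP[] := Bx i.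
  by rewrite ltNge; apply/negP.
rewrite -nneseriesD; [|by move=> *; exact: box_volume_ge0..].
by under eq_eseriesr do rewrite box_volume_cut.
Qed.

Lemma measurable_coord i : measurable_fun [set: E] (fun x : E => x ord0 i : R).
Proof.
move=> _; apply: (measurability _ (RGenInftyO.measurableE R)) => //.
move=> _ [_ [c ->] <-]; rewrite setTI.
rewrite (_ : _ @^-1` _ =
    \bigcup_k [set x : 'rV[R]_n.+1 | (x ord0 i <= c - k.+1%:R^-1)%R]); last first.
  apply/seteqP; split=> [x|x [k _]] /=; rewrite in_itv/=; last first.
    by move=> /le_lt_trans; apply; rewrite ltrBlDr ltrDl.
  move=> xc; have cx0 : (0 < c - x ord0 i)%R by rewrite subr_gt0.
  have [k _ kc] := near_infty_natSinv_lt (PosNum cx0).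
  exists k => //=; rewrite lerBrDr addrC -lerBrDr.
  exact: ltW (kc k (leqnn _)).
by apply: bigcupT_measurable => k; exact: halfspace_measurable.
Qed.

Lemma measurable_euclid : measurable_fun [set: E] (euclid : E -> R).
Proof.
rewrite /euclid; apply: (measurableT_comp (f := @Num.sqrt R)).
  by apply: continuous_measurable_fun; exact: sqrt_continuous.
apply: measurable_sum => i; apply: measurable_funX; exact: measurable_coord.
Qed.

Lemma measurable_Ball t : measurable (Ball t : set E).
Proof.
have mt : measurable (`]-oo, t[%classic : set R) by exact: measurable_itv.
have := measurable_euclid measurableT _ mt.
by rewrite setTI (_ : euclid @^-1` _ = Ball t)//.
Qed.

Lemma euclid_ge0 (x : 'rV[R]_n.+1) : (0 <= euclid x)%R.
Proof. exact: sqrtr_ge0. Qed.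

Lemma coord_le_euclid (x : 'rV[R]_n.+1) i : (`|x ord0 i| <= euclid x)%R.
Proof.
rewrite -sqrtr_sqr ler_wsqrtr// (bigD1 i)//= lerDl sumr_ge0// => j _.
exact: sqr_ge0.
Qed.

(** The origin has to be excluded because the norm of [omega1] over [(0, |x|)] vanishes there. *)
Lemma euclid0_negligible : mu [set x : 'rV[R]_n.+1 | euclid x = 0%R] = 0.
Proof.
apply/eqP; rewrite eq_le measure_ge0 andbT.
apply/lee_addgt0Pr => e e0; rewrite add0e.
pose b : 'rV[R]_n.+1 := \row_i if i == ord0 then e else 1%R.
(* [b *+ 0] is the zero vector: the first box surrounds the origin with one side [e] and all others
   1, and the remaining boxes are empty. *)
pose B k : 'rV[R]_n.+1 * 'rV[R]_n.+1 :=
  if k is 0%N then (b *+ 0 - \row_i (if i == ord0 then (e / 2) else 2^-1), b *+ 0 + \row_i (if i == ord0 then (e / 2) else 2^-1))%R else (0, 0)%R.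
apply: ge_ereal_inf.
exists (\sum_(k <oo) box_volume (B k)).
  exists B => // x /= x0; exists 0%N => // i.
  have := coord_le_euclid x i; rewrite x0 normr_le0 => /eqP ->.
  by rewrite !mxE; case: ifP => _; lra.
rewrite (@nneseries_split _ _ 0 1); last by move=> *; exact: box_volume_ge0.
rewrite add0n big_nat1 eseries0 ?adde0.
  rewrite /box_volume lee_fin (bigD1 ord0)//= big1 ?mulr1 => [|i /negPf i0].
    by rewrite !mxE eqxx ge_max; apply/andP; split; lra.
  by rewrite !mxE i0 (_ : _ - _ = 1)%R ?(max_idPr ler01)//; lra.
move=> [|k]// _ _; rewrite /box_volume big_ord_recl/= subrr maxxx mul0r//.
Qed.

Lemma lebesgue_measure_box_lty ab : mu (box ab) < +oo.
Proof.
apply: (@le_lt_trans _ _ (box_volume ab)); last exact: ltry.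
pose B k : 'rV[R]_n.+1 * 'rV[R]_n.+1 := if k is 0%N then ab else (0, 0)%R.
apply: ge_ereal_inf; exists (\sum_(k <oo) box_volume (B k)).
  by exists B => // x bx; exists 0%N.
rewrite (@nneseries_split _ _ 0 1); last by move=> *; exact: box_volume_ge0.
rewrite add0n big_nat1 eseries0 ?adde0//.
move=> [|k]// _ _; rewrite /box_volume big_ord_recl/= subrr maxxx mul0r//.
Qed.

Lemma Ball_lebesgue_measure_lty t : mu (Ball t) < +oo.
Proof.
apply: le_lt_trans (lebesgue_measure_box_lty (const_mx (- t), const_mx t)%R).
apply: le_lebesgue_outer => x xt i; rewrite !mxE.
have := le_lt_trans (coord_le_euclid x i) xt.
by rewrite ltr_norml => /andP[-> /ltW].
Qed.

Lemma lebesgue_measure_rV_sigma_finite : sigma_finite [set: E] mu.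
Proof.
exists (fun k => Ball k%:R); last first.
  by move=> k; split; [exact: measurable_Ball|exact: Ball_lebesgue_measure_lty].
apply/seteqP; split=> // x _; exists (Num.truncn (euclid x)).+1 => //.
exact: truncnS_gt.
Qed.

HB.instance Definition _ :=
  @Measure_isSigmaFinite.Build _ _ _ mu lebesgue_measure_rV_sigma_finite.

Lemma compact_subset_Ball (K : set 'rV[R]_n.+1) : compact K ->
  exists2 t, (0 < t)%R & K `<=` Ball t.
Proof.
move=> /compact_bounded [M [_ KM]].
pose r := (`|M| + 1)%R.
have r0 : (0 < r)%R by rewrite ltr_wpDl.
have Mr : (M < r)%R by rewrite (le_lt_trans (ler_norm _))// ltrDl.
exists (Num.sqrt (n.+1%:R * r ^+ 2) + 1)%R; first by rewrite ltr_wpDl ?sqrtr_ge0.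
move=> x Kx; rewrite /Ball/= /euclid.
apply: (@le_lt_trans _ _ (Num.sqrt (n.+1%:R * r ^+ 2))); last by rewrite ltrDl.
rewrite ler_wsqrtr// -[in leRHS](card_ord n.+1) mulr_natl -sumr_const.
apply: ler_sum => i _.
rewrite -real_normK ?num_real// lerXn2r ?nnegrE ?(ltW r0)//.
apply: le_trans (KM _ Mr _ Kx).
rewrite [leRHS]mx_normrE.
exact: (@le_bigmax _ _ _ 0%R (fun ij => `|x ij.1 ij.2|%R) (ord0, i)).
Qed.

End euclidean_space.

(** The integral of a nonnegative function is a supremum over simple functions below it, so
    monotonicity in the set holds without measurability; this serves for arbitrary compact sets. *)
Lemma le_integral_subset_nonmeasurable d (T : measurableType d) (R : realType)
    (mu : {measure set T -> \bar R}) (K D : set T) (f : T -> \bar R) :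
  (forall x, 0 <= f x) -> K `<=` D ->
  \int[mu]_(x in K) f x <= \int[mu]_(x in D) f x.
Proof.
move=> f0 KD; rewrite !ge0_integralE//; apply: le_ereal_sup => _ [h hf <-].
exists h => // x; apply: le_trans (hf x) _; rewrite /patch.
case: ifPn => [/set_mem/KD/mem_set ->//|_]; case: ifPn => // _.
Qed.

Section completed_line.
Context {R : realType}.
Local Notation L := (caratheodory_type (@wlength R idfun)^*%mu).
Local Notation lam := (@completed_lebesgue_measure R).

Definition line_val : L -> R := fun x => x.

Lemma measurable_line_val : measurable_fun [set: L] line_val.
Proof.
move=> _ Y mY; rewrite setTI.
have -> : line_val @^-1` Y = Y by [].
exact: (@sub_caratheodory _ (ocitv_type R) R (@wlength R idfun) Y mY).
Qed.

Lemma completed_lebesgue_measure_set1 (x : R) : lam [set x] = 0.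
Proof. exact: (lebesgue_measure_set1 x). Qed.

Lemma measurable_line_itv (I : interval R) : measurable ([set` I] : set L).
Proof.
have := measurable_line_val measurableT _ (measurable_itv I).
by rewrite setTI.
Qed.

Lemma norm_R_poweR (p : R) (D : set R) (f : R -> \bar R) : p != 0%R ->
  norm_R p%:E D f `^ p = \int[lam]_(x in D) (`|f x| `^ p).
Proof. exact: Lnorm_restrict_poweR. Qed.

Lemma norm_RE (p : R) (D : set R) (f : R -> \bar R) : p != 0%R ->
  norm_R p%:E D f = (\int[lam]_(x in D) (`|f x| `^ p)) `^ p^-1.
Proof. exact: Lnorm_restrictE. Qed.

(** Tonelli's theorem produces the condition [t <= |x|], while the norm of [omega1] is over an open
    interval; the end point is null. *)
Lemma integral_line_itvoc (f : R -> \bar R) (a b : R) :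
  measurable_pos f -> (forall x, 0 <= f x) -> (0 <= a)%R ->
  \int[lam]_(x in `]a, b]) f x = \int[lam]_(x in `]a, b[) f x.
Proof.
move=> mf f0 a0.
rewrite (@ge0_negligible_integral _ _ _ lam _ [set b])//; last 4 first.
- by rewrite -set_itv1; exact: measurable_line_itv.
- exact: measurable_line_itv.
- apply: (measurable_funS _ _ mf); first exact: measurable_line_itv.
  by move=> x /=; rewrite !in_itv/= andbT => /andP[ax _]; exact: le_lt_trans ax.
- exact: completed_lebesgue_measure_set1.
congr integral; apply/seteqP; split=> x /=; rewrite !in_itv/=.
  by move=> [/andP[-> xb] /eqP xNb]; rewrite lt_neqAle xb andbT.
by move=> /andP[-> xb]; rewrite ltW//; split=> //; apply/eqP; rewrite lt_eqF.
Qed.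

Variables (th : R) (omega : R -> \bar R).
Hypotheses (th0 : (0 < th)%R) (omegaP : Omega th%:E omega).

Definition weight_tail := @integral_tail R _ L lam line_val (fun t => `|omega t| `^ th).

Lemma measurable_pos_poweR (f : R -> \bar R) p :
  measurable_pos f -> measurable_pos (fun t => `|f t| `^ p).
Proof.
move=> mf; apply: (measurable_poweR_comp _ L R).
exact: measurableT_comp.
Qed.

Let tail_gt0 t : (0 < t)%R ->
  0 < \int[lam]_(z in line_val @^-1` `]t, +oo[) (`|omega z| `^ th).
Proof.
move=> t0; have [_ _ /(_ _ t0)[h _]] := omegaP.
have := poweR_gt0 th h; rewrite norm_R_poweR ?gt_eqF//.
Qed.

Let tail_lty t : (0 < t)%R ->
  \int[lam]_(z in line_val @^-1` `]t, +oo[) (`|omega z| `^ th) < +oo.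
Proof.
move=> t0; have [_ _ /(_ _ t0)[_ h]] := omegaP.
have := poweR_lty th h; rewrite norm_R_poweR ?gt_eqF//.
Qed.

Let mdelta : measurable_fun (line_val @^-1` `]0%R, +oo[) (fun t : L => `|omega t| `^ th).
Proof. by have [mo _ _] := omegaP; exact: measurable_pos_poweR. Qed.

Lemma weight_tail_tail_function : tail_function weight_tail.
Proof.
apply: integral_tail_tail_function => //.
- exact: measurable_line_val.
- by move=> x _; exact: poweR_ge0.
- exact: completed_lebesgue_measure_set1.
Qed.

Lemma weight_tailE t : (0 < t)%R ->
  norm_R th%:E `]t, +oo[ omega = (weight_tail t `^ th^-1)%:E.
Proof.
move=> t0; rewrite norm_RE ?gt_eqF// -poweR_EFin fineK// ge0_fin_numE.
  exact: tail_lty.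
by rewrite ltW// tail_gt0.
Qed.

Lemma weight_tail_functional : tail_functional weight_tail 1
  (fun F => \int[lam]_(t in `]0%R, +oo[) (F t * `|omega t| `^ th)).
Proof.
apply: (@integral_tail_functional R _ L lam line_val).
- exact: measurable_line_val.
- exact: mdelta.
- by move=> x _; exact: poweR_ge0.
- exact: weight_tail_tail_function.
- exact: ltr01.
- apply: integral_itv_tail => //.
  + exact: measurable_line_val.
  + by move=> x _; exact: poweR_ge0.
  + exact: completed_lebesgue_measure_set1.
Qed.

End completed_line.

(** * The embedding as a Hardy inequality *)

Section measurable_products.
Context d (T : measurableType d) (R : realType).
Implicit Types (f g k : T -> \bar R) (S : set T).

Lemma measurable_norm_mul f g k : measurable_fun setT f -> measurable_fun setT g ->
  measurable_fun setT k -> measurable_fun setT (fun x => `|f x * (g x * k x)|).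
Proof.
move=> mf mg mk; apply: measurableT_comp => //.
by apply: emeasurable_funM => //; exact: emeasurable_funM.
Qed.

Lemma measurable_norm_mulr f g k : measurable_fun setT f -> measurable_fun setT g ->
  measurable_fun setT k -> measurable_fun setT (fun x => `|f x * g x| * k x).
Proof.
move=> mf mg mk; apply: emeasurable_funM => //; apply: measurableT_comp => //.
exact: emeasurable_funM.
Qed.

Lemma measurable_norm_mul_poweR S f g p : measurable_fun setT f ->
  measurable_fun setT g -> measurable_fun S (fun x => `|f x * g x| `^ p).
Proof.
move=> mf mg; apply: measurable_poweR_comp; apply: measurableT_comp => //.
by apply: emeasurable_funM; exact: measurable_funTS.
Qed.

Lemma measurable_mul_poweR S f g p : measurable_fun setT f ->
  measurable_fun setT g -> measurable_fun S (fun x => (f x * g x) `^ p).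
Proof.
move=> mf mg; apply: measurable_poweR_comp.
by apply: emeasurable_funM; exact: measurable_funTS.
Qed.

Lemma measurable_mul_inve f g k : measurable_fun setT f -> measurable_fun setT g ->
  measurable_fun setT k -> measurable_fun setT (fun x => f x * ((g x)^-1 * (k x)^-1)).
Proof.
move=> mf mg mk; apply: emeasurable_funM => //.
by apply: emeasurable_funM; exact: (measurableT_comp measurable_inve).
Qed.

End measurable_products.

Section complementary_norm.
Context {R : realType} {n : nat}.
Local Notation T := (caratheodory_type (@lebesgue_outer R n)).
Local Notation mu := (@lebesgue_measure_rV R n).
Local Notation L := (caratheodory_type (@wlength R idfun)^*%mu).
Local Notation lam := (@completed_lebesgue_measure R).

(** Tonelli's theorem on the set where [t <= |x|], that is, where [x] lies outside the open ball of
    radius [t]. *)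
Lemma fubini_complement_Ball (delta : R -> \bar R) (h : T -> \bar R) :
  measurable_pos delta -> (forall t, 0 <= delta t) ->
  measurable_fun setT h -> (forall x, 0 <= h x) ->
  \int[lam]_(t in `]0%R, +oo[) ((\int[mu]_(x in ~` Ball t) h x) * delta t) =
  \int[mu]_x (h x * \int[lam]_(t in `]0%R, euclid x[) delta t).
Proof.
move=> md d0 mh h0.
(* [delta] is measurable on the half-line only, so it is extended by 0 before the product function
   is formed. *)
pose D := (delta \_ `]0%R, +oo[) : L -> \bar R.
have mD : measurable_fun setT D.
  by apply/(measurable_restrictT _ (measurable_line_itv _)).
have D0 t : 0 <= D t by rewrite /D /patch; case: ifP.
pose f (z : L * T) := D z.1 * (if ((z.1 : R) <= euclid z.2)%R then h z.2 else 0).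
have mf : measurable_fun setT f.
  apply: emeasurable_funM; first exact: measurableT_comp.
  apply: measurable_fun_ifT => //.
  - apply: measurable_fun_ler.
      exact: (measurableT_comp measurable_line_val measurable_fst).
    exact: (measurableT_comp measurable_euclid measurable_snd).
  - exact: measurableT_comp.
have f0 z : 0 <= f z by rewrite mule_ge0//; case: ifP.
transitivity (\int[lam]_t \int[mu]_x f (t, x)).
  rewrite integral_mkcond; apply: eq_integral => t _.
  rewrite {1}/patch; case: ifPn => tpos; last first.
    rewrite integral0_eq// => x _; rewrite /f /= /D /patch (negPf tpos) mul0e//.
  rewrite muleC -ge0_integralZl//; last 2 first.
  - by apply: measurableC; exact: measurable_Ball.
  - exact: measurable_funS mh.
  rewrite integral_mkcond; apply: eq_integral => x _.
  rewrite /f/= /D /patch tpos; case: ifPn => [/set_mem|/negP xB].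
    by rewrite /Ball/= => /negP; rewrite -leNgt => ->.
  rewrite ifF ?mule0//; apply/negbTE; rewrite -ltNge ltNge; apply/negP => tx.
  by apply: xB; apply/mem_set; rewrite /Ball/=; apply/negP; rewrite -leNgt.
rewrite (@fubini_tonelli _ _ _ _ _ lam mu f mf f0).
apply: eq_integral => x _.
rewrite -integral_line_itvoc//.
rewrite -ge0_integralZl//; last 2 first.
- exact: measurable_line_itv.
- apply: (measurable_funS _ _ md); first exact: measurable_line_itv.
  by move=> t /=; rewrite !in_itv/= andbT => /andP[].
rewrite [RHS]integral_mkcond; apply: eq_integral => t _.
rewrite /f /= /D /patch; case: ifPn => [/set_mem|/negP tpos]; last first.
  rewrite mul0e; case: ifPn => // /set_mem /=; rewrite in_itv/= => /andP[t0 _].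
  by exfalso; apply: tpos; apply/mem_set; rewrite /= in_itv/= t0.
rewrite /= in_itv/= andbT => t0; case: ifPn => tx.
  by rewrite ifT 1?muleC//; apply/mem_set; rewrite /= in_itv/= t0.
rewrite mule0 ifF//; apply/negbTE/negP => /set_mem; rewrite /= in_itv/= => /andP[_].
exact/negP.
Qed.

Lemma norm_rVE (p : R) (D : set 'rV[R]_n.+1) (f : 'rV[R]_n.+1 -> \bar R) : p != 0%R ->
  norm_rV p%:E D f = (\int[mu]_(x in D) (`|f x| `^ p)) `^ p^-1.
Proof. exact: (@Lnorm_restrictE _ T R mu). Qed.

Lemma norm_rV_poweR (p : R) (D : set 'rV[R]_n.+1) (f : 'rV[R]_n.+1 -> \bar R) : p != 0%R ->
  norm_rV p%:E D f `^ p = \int[mu]_(x in D) (`|f x| `^ p).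
Proof. exact: (@Lnorm_restrict_poweR _ T R mu). Qed.

Lemma LM_norm_poweR (q th : R) omega (v f : 'rV[R]_n.+1 -> \bar R) :
  (0 < q)%R -> (0 < th)%R ->
  LM_norm q%:E th%:E omega v f `^ th = \int[lam]_(t in `]0%R, +oo[)
    ((\int[mu]_(x in Ball t) (`|f x * v x| `^ q)) `^ (th / q) * `|omega t| `^ th).
Proof.
move=> q0 th0; rewrite /LM_norm norm_R_poweR ?gt_eqF//; apply: eq_integral => t _.
rewrite abseM poweRM// norm_rVE ?gt_eqF// gee0_abs ?poweR_ge0//.
by rewrite -poweRrM mulrC.
Qed.

(** Equality of the inner and outer exponents is what lets Tonelli's theorem apply: no power
    separates the two integrals. *)
Lemma cLM_norm_poweR (p : R) omega (v f : 'rV[R]_n.+1 -> \bar R) :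
  (0 < p)%R -> measurable_pos omega -> measurable_rV f -> measurable_rV v ->
  cLM_norm p%:E p%:E omega v f `^ p =
  \int[mu]_x ((`|f x * v x| * norm_R p%:E `]0%R, euclid x[ omega) `^ p).
Proof.
move=> p0 mo mf mv; rewrite /cLM_norm norm_R_poweR ?gt_eqF//.
transitivity (\int[lam]_(t in `]0%R, +oo[)
    ((\int[mu]_(x in ~` Ball t) (`|f x * v x| `^ p)) * `|omega t| `^ p)).
  by apply: eq_integral => t _; rewrite abseM poweRM// gee0_abs ?Lnorm_ge0// norm_rV_poweR ?gt_eqF.
rewrite (@fubini_complement_Ball (fun t => `|omega t| `^ p)
  (fun x => `|f x * v x| `^ p)); first last.
- by move=> x; exact: poweR_ge0.
- exact: (measurable_norm_mul_poweR _ T R _ _ _ _ mf mv).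
- by move=> t; exact: poweR_ge0.
- exact: measurable_pos_poweR.
apply: eq_integral => x _.
by rewrite poweRM ?Lnorm_ge0// norm_R_poweR ?gt_eqF.
Qed.

End complementary_norm.

Section embedding.
Context {R : realType} {n : nat}.
Local Notation T := (caratheodory_type (@lebesgue_outer R n)).
Local Notation mu := (@lebesgue_measure_rV R n).
Local Notation lam := (@completed_lebesgue_measure R).
Variables (p q th : R).
Hypotheses (p0 : (0 < p)%R) (q0 : (0 < q)%R) (qp : (q <= p)%R) (th0 : (0 < th)%R).
Variables (v1 v2 : 'rV[R]_n.+1 -> \bar R) (omega1 omega2 : R -> \bar R).
Hypotheses (v1P : weight v1) (v2P : weight v2).
Hypotheses (omega1P : cOmega p%:E omega1) (omega2P : Omega th%:E omega2).

Let Om s := norm_R p%:E `]0%R, s[ omega1.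

(** The absolute value makes the weight nonnegative everywhere, although [v1] and [v2] are positive
    only almost everywhere. *)
Definition hardy_weight (x : 'rV[R]_n.+1) : \bar R :=
  `|(norm_R p%:E `]0%R, euclid x[ omega1)^-1 * ((v1 x)^-1 * v2 x)|.
Local Notation u := hardy_weight.

Lemma hardy_weight_ge0 x : 0 <= u x. Proof. exact: abse_ge0. Qed.

Let measurable_Om : measurable_fun setT (fun x : T => Om (euclid x)).
Proof.
apply: (measurableT_comp _ measurable_euclid).
move=> mD; apply: (measurability _ (ErealGenOInfty.measurableE R)) => //.
move=> _ [_ [c ->] <-]; rewrite setTI; apply: is_interval_measurable => x y /=.
rewrite !in_itv/= !andbT => cx _ z /andP[xz _]; rewrite in_itv/= andbT; apply: (lt_le_trans cx).
rewrite /Om !norm_RE ?gt_eqF//; apply: le_poweR.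
- by rewrite invr_ge0 ltW.
- by apply: integral_ge0 => t _; exact: poweR_ge0.
apply: le_integral_subset_nonmeasurable => [t|t /=]; first exact: poweR_ge0.
by rewrite !in_itv/= => /andP[-> tx]; exact: lt_le_trans xz.
Qed.

Lemma measurable_hardy_weight : measurable_rV u.
Proof.
have [mv1 _] := v1P; have [mv2 _] := v2P.
have mOmV : measurable_fun setT (fun x : T => (Om (euclid x))^-1).
  exact: (measurableT_comp measurable_inve).
have mv1V : measurable_fun setT (fun x : T => (v1 x)^-1).
  exact: (measurableT_comp measurable_inve).
exact: (measurable_norm_mul _ T R _ _ _ mOmV mv1V mv2).
Qed.

#[local] Instance ae_filter_lebesgue : Filter (nbhs (almost_everywhere mu)).
Proof. exact: (@ae_filter_ringOfSetsType _ T R mu). Qed.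

Let weights_ae : {ae mu, forall x : T, exists o a b : R,
  [/\ (0 < o)%R, (0 < a)%R, (0 < b)%R, Om (euclid x) = o%:E &
     v1 x = a%:E /\ v2 x = b%:E]}.
Proof.
have [_ v1ae] := v1P; have [_ v2ae] := v2P.
have x0 : {ae mu, forall x : T, (0 < euclid x)%R}.
  exists [set x : T | euclid x = 0%R]; split.
  - have m0 : measurable ([set 0%R] : set R) by exact: measurable_set1.
    have := @measurable_euclid R n measurableT _ m0; rewrite setTI.
    by rewrite (_ : euclid @^-1` _ = [set x : T | euclid x = 0%R]).
  - exact: euclid0_negligible.
  - move=> x /= /negP; rewrite -leNgt => xle0.
    by apply/eqP; rewrite eq_le xle0 euclid_ge0.
move: v1ae v2ae x0; apply: filterS3 => x [a0 ay] [b0 bfin] x_gt0.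
have [_ _ h] := omega1P; have [k0 ky] := h _ x_gt0.
have fin (y : \bar R) : 0 < y -> y < +oo -> y = (fine y)%:E.
  by move=> y0 yy; rewrite fineK// ge0_fin_numE// ltW.
exists (fine (Om (euclid x))), (fine (v1 x)), (fine (v2 x)).
by split; rewrite ?fine_gt0 ?a0 ?b0 ?k0//; [exact: fin|split; exact: fin].
Qed.

Let H (g : T -> \bar R) s := \int[mu]_(x in Ball s) ((g x * u x) `^ q).
Let E (F : R -> \bar R) :=
  \int[lam]_(t in `]0%R, +oo[) (F t * `|omega2 t| `^ th).

Let X := cLM p%:E p%:E omega1 v1.
Let Y := LM q%:E th%:E omega2 v2.
Let normX := cLM_norm p%:E p%:E omega1 v1.
Let normY := LM_norm q%:E th%:E omega2 v2.

Let normX_ge0 f : 0 <= normX f. Proof. exact: Lnorm_ge0. Qed.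
Let normY_ge0 f : 0 <= normY f. Proof. exact: Lnorm_ge0. Qed.

Let normY_hardy (f : 'rV[R]_n.+1 -> \bar R) (g : T -> \bar R) : measurable_rV f ->
  measurable_fun setT g ->
  {ae mu, forall x : T, `|f x * v2 x| = g x * u x} ->
  (forall s, \int[mu]_(x in Ball s) (`|f x * v2 x| `^ q) = H g s) /\
  normY f `^ th = E (fun s => H g s `^ (th / q)).
Proof.
move=> mf mg fg; have [mv2 _] := v2P.
have mu_ := measurable_hardy_weight.
have h s : \int[mu]_(x in Ball s) (`|f x * v2 x| `^ q) = H g s.
  apply: ge0_ae_eq_integral.
  - exact: measurable_Ball.
  - exact: (measurable_norm_mul_poweR _ T R _ _ _ _ mf mv2).
  - exact: (measurable_mul_poweR _ T R _ _ _ _ mg mu_).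
  - by move=> x _; exact: poweR_ge0.
  - by move=> x _; exact: poweR_ge0.
  - by apply: filterS fg => x /= -> _.
split; first exact: h.
rewrite /normY LM_norm_poweR; [|exact: q0|exact: th0].
by apply: eq_integral => t _; rewrite h.
Qed.

(** The substitution [g = |f * v1| * Om] gives [|f * v2| = g * u] almost everywhere and turns the
    norm of [f] into the p-norm of [g]. *)
Lemma embedding_norm_le (K : R) : (0 <= K)%R ->
  (forall s, (0 < s)%R -> 'N[mu]_(arrow p%:E q%:E)[u \_ (Ball s)] < +oo) ->
  (forall g (l : R), measurable_fun setT g -> (forall x, 0 <= g x) ->
    (0 < l)%R -> \int[mu]_x (g x `^ p) <= (l `^ p)%:E ->
    E (fun s => H g s `^ (th / q)) <= ((K * l) `^ th)%:E) ->
  embedding_norm X Y normX normY <= K%:E.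
Proof.
move=> K0 Psiy hardy; apply: ereal_inf_lbound; exists K => //; split=> // f [mf _ fN].
have [mv1 _] := v1P; have [mo1 _ _] := omega1P.
pose g (x : T) := `|f x * v1 x| * Om (euclid x).
have mg : measurable_fun setT g.
  exact: (measurable_norm_mulr _ T R _ _ _ mf mv1 measurable_Om).
have g0 x : 0 <= g x by rewrite mule_ge0// Lnorm_ge0.
have gN : \int[mu]_x (g x `^ p) = normX f `^ p.
  exact/esym/(cLM_norm_poweR _ _ _ _ p0 mo1 mf mv1).
have [HE normYE] : (forall s, \int[mu]_(x in Ball s) (`|f x * v2 x| `^ q) = H g s) /\
    normY f `^ th = E (fun s => H g s `^ (th / q)).
  apply: normY_hardy => //; apply: filterS weights_ae.
  move=> x [k [a [b [k0 a0 b0 kE [aE bE]]]]].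
  have absM (y : R) : (0 < y)%R -> `|f x * y%:E| = `|f x| * y%:E.
    by move=> y0; rewrite abseM (@gee0_abs _ y%:E)// lee_fin ltW.
  rewrite /g /u -/(Om _) kE aE bE !absM// !inver !gt_eqF// -!EFinM (@gee0_abs _ (_%:E)); last first.
    by rewrite lee_fin !mulr_ge0 ?invr_ge0 ?ltW.
  rewrite -!muleA -!EFinM; congr (_ * _%:E).
  by rewrite (mulrA k) mulfV ?gt_eqF// mul1r mulrA mulfV ?gt_eqF// mul1r.
have Nfin : normX f \is a fin_num by rewrite ge0_fin_numE.
have N0 : (0 <= fine (normX f))%R by rewrite fine_ge0.
have YX : normY f <= K%:E * normX f.
  apply/lee_addgt0Pr => e e0.
  have K1 : (0 < K + 1)%R by rewrite ltr_wpDl.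
  (* The norm of [f] may be 0, so a positive amount is added; [K * e / (K + 1) <= e] keeps the error
     below [e]. *)
  pose l := (fine (normX f) + e / (K + 1))%R.
  have l0 : (0 < l)%R by rewrite ltr_wpDl// divr_gt0.
  have := hardy g l mg g0 l0; rewrite gN -normYE -!poweR_EFin.
  rewrite !lee_poweR2 ?lee_fin ?mulr_ge0 ?(ltW l0)// => /(_ _)/le_trans; apply.
    by rewrite -(fineK Nfin) lee_fin lerDl divr_ge0// ltW.
  rewrite -(fineK Nfin) -EFinM -EFinD lee_fin /l mulrDr lerD2l.
  by rewrite mulrCA ler_piMr ?(ltW e0)// ler_pdivrMr// mul1r lerDl.
split=> //; split => //; last first.
  by apply: le_lt_trans YX _; rewrite -(fineK Nfin) -EFinM ltry.
(* Finiteness of the norm over compact sets is part of membership in the target space; it follows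
   from Hoelder's inequality on a ball containing [C]. *)
move=> C /compact_subset_Ball[t t0 Ct].
apply: (@le_lt_trans _ _ (norm_rV q%:E (Ball t) (f \* v2))).
  rewrite !norm_rVE ?gt_eqF//; apply: le_poweR; first by rewrite invr_ge0 ltW.
    by apply: integral_ge0 => x _; exact: poweR_ge0.
  by apply: le_integral_subset_nonmeasurable => // x; exact: poweR_ge0.
rewrite norm_rVE ?gt_eqF//; apply: poweR_lty.
have -> : \int[mu]_(x in Ball t) (`|(f \* v2) x| `^ q) = H g t by exact: HE.
have mBt : measurable (Ball t : set T) by exact: measurable_Ball.
have gy : \int[mu]_(x in Ball t) (g x `^ p) < +oo.
  apply: (@le_lt_trans _ _ (normX f `^ p)); last exact: poweR_lty.
  by rewrite -gN; apply: le_integral_subset_nonmeasurable => // x; exact: poweR_ge0.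
have := arrow_norm_hoelder_pow _ T R mu p q p0 q0 qp (Ball t) g u mBt
  (measurable_funTS mg) (measurable_funTS measurable_hardy_weight) g0
  hardy_weight_ge0 gy (Psiy _ t0).
move=> /le_lt_trans; apply.
rewrite lte_mul_pinfty ?lee_fin//; apply: poweR_lty.
rewrite lte_mul_pinfty ?poweR_ge0 ?Psiy//.
rewrite ge0_fin_numE ?poweR_ge0//; exact: poweR_lty.
Qed.

(** The inverse substitution [f = g / (Om * v1)]; the embedding applies once [f] is shown to lie in
    the source space. *)
Lemma embedding_hardy (c : R) : (0 <= c)%R ->
  (forall f, X f -> Y f /\ normY f <= c%:E * normX f) ->
  forall g (l : R), measurable_fun setT g -> (forall x, 0 <= g x) ->
    (0 <= l)%R -> \int[mu]_x (g x `^ p) <= (l `^ p)%:E ->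
    E (fun s => H g s `^ (th / q)) <= ((c * l) `^ th)%:E.
Proof.
move=> c0 XY g l mg g0 l0 gl.
have [mv1 _] := v1P; have [mo1 _ _] := omega1P.
pose f (x : 'rV[R]_n.+1) := g x * ((Om (euclid x))^-1 * (v1 x)^-1).
have mf : measurable_rV f.
  exact: (measurable_mul_inve _ T R _ _ _ mg measurable_Om mv1).
have [_ normYE] : (forall s, \int[mu]_(x in Ball s) (`|f x * v2 x| `^ q) = H g s) /\
    normY f `^ th = E (fun s => H g s `^ (th / q)).
  apply: normY_hardy => //; apply: filterS weights_ae.
  move=> x [k [a [b [k0 a0 b0 kE [aE bE]]]]].
  by rewrite /f /u -/(Om _) kE aE bE -!muleA abseM gee0_abs.
have fg : {ae mu, forall x : T, `|f x * v1 x| * Om (euclid x) = g x}.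
  apply: filterS weights_ae => x [k [a [b [k0 a0 b0 kE [aE bE]]]]].
  rewrite /f kE aE !inver !gt_eqF// gee0_abs; last first.
    by rewrite !mule_ge0 ?g0 ?lee_fin ?invr_ge0 ?(ltW k0) ?(ltW a0).
  rewrite -!muleA -!EFinM -[RHS]mule1; congr (_ * _%:E).
  by rewrite (mulrA a^-1)%R mulVf ?gt_eqF// mul1r mulVf// gt_eqF.
have mfv1 S : measurable_fun S (fun x : T => `|f x * v1 x| `^ p).
  exact: (measurable_norm_mul_poweR _ T R _ _ _ _ mf mv1).
have mfOm S : measurable_fun S (fun x : T => (`|f x * v1 x| * Om (euclid x)) `^ p).
  apply: measurable_poweR_comp; apply: measurable_funTS.
  exact: (measurable_norm_mulr _ T R _ _ _ mf mv1 measurable_Om).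
have normXE : normX f `^ p = \int[mu]_x (g x `^ p).
  rewrite /normX (cLM_norm_poweR _ _ _ _ p0 mo1 mf mv1).
  apply: ge0_ae_eq_integral.
  - exact: measurableT.
  - exact: mfOm.
  - exact: measurable_poweR_comp.
  - by move=> x _; exact: poweR_ge0.
  - by move=> x _; exact: poweR_ge0.
  - by apply: filterS fg => x /= -> _.
have normXl : normX f <= l%:E by rewrite -(lee_poweR2 p)// ?lee_fin// normXE poweR_EFin.
have Xf : X f.
  split=> //; last exact: le_lt_trans normXl (ltry _).
  move=> t t0; have [_ _ /(_ _ t0)[k0 ky]] := omega1P.
  rewrite norm_rVE ?gt_eqF//; apply: poweR_lty.
  set I := \int[mu]_(x in _) _.
  have I0 : 0 <= I by apply: integral_ge0 => x _; exact: poweR_ge0.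
  (* Outside the ball of radius [t] the weight [Om] is at least [Om t > 0], so the integral over the
     complement is controlled by the norm of [f]. *)
  have : I * (Om t `^ p) < +oo.
    apply: (@le_lt_trans _ _ (normX f `^ p)); last first.
      by apply: poweR_lty; exact: le_lt_trans normXl (ltry _).
    have mC : measurable (~` Ball t : set T) by apply: measurableC; exact: measurable_Ball.
    rewrite muleC /I.
    rewrite -(ge0_integralZl mu mC (mfv1 _) (fun x _ => poweR_ge0 _ _) (poweR_ge0 _ _)).
    rewrite /normX (cLM_norm_poweR _ _ _ _ p0 mo1 mf mv1).
    apply: (@le_trans _ _ (\int[mu]_(x in ~` Ball t) ((`|f x * v1 x| * Om (euclid x)) `^ p))).
      apply: ge0_le_integral.
      * exact: mC.
      * by move=> x _; rewrite mule_ge0 ?poweR_ge0.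
      * by apply: emeasurable_funM; [exact: measurable_cst|exact: mfv1].
      * exact: mfOm.
      * move=> x /negP; rewrite /Ball/= -leNgt => tx.
        rewrite poweRM ?Lnorm_ge0// muleC lee_wpmul2l ?poweR_ge0//.
        apply: le_poweR; rewrite ?Lnorm_ge0 ?(ltW p0)//.
        rewrite /Om !norm_RE ?gt_eqF//; apply: le_poweR; first by rewrite invr_ge0 ltW.
          by apply: integral_ge0 => s _; exact: poweR_ge0.
        apply: le_integral_subset_nonmeasurable => [s|s /=]; first exact: poweR_ge0.
        by rewrite !in_itv/= => /andP[-> st]; exact: lt_le_trans tx.
    by apply: le_integral_subset_nonmeasurable => // x; exact: poweR_ge0.
  have op0 : 0 < Om t `^ p by exact: poweR_gt0.
  have [->|Iy _] := eqVneq I +oo; first by rewrite gt0_mulye.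
  by rewrite ltey.
have [_ YX] := XY f Xf.
rewrite -normYE -poweR_EFin; apply: le_poweR; rewrite ?normY_ge0 ?(ltW th0)//.
by apply: (le_trans YX); rewrite EFinM lee_wpmul2l// lee_fin.
Qed.

End embedding.

(** * The two-sided estimate of the embedding norm *)

Lemma equiv_up_to_embedding_norm (R : realType) (F : Type) (X Y : set F)
    (normX normY : F -> \bar R) (B : \bar R) (lambda C : R) :
  0 <= B -> (1 <= lambda)%R -> (C <= lambda)%R ->
  (forall d : R, (0 < d)%R -> B < d%:E ->
    embedding_norm X Y normX normY <= (C * d)%:E) ->
  (forall c : R, (0 <= c)%R ->
    (forall f, X f -> Y f /\ normY f <= c%:E * normX f) ->
    B <= (lambda * c)%:E) ->
  equiv_up_to lambda (embedding_norm X Y normX normY) B.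
Proof.
move=> B0 l1 Cl le_emb ge_emb; have l0 : (0 < lambda)%R by exact: lt_le_trans l1.
split.
  apply: le_ereal_inf_tmp => _ [c [c0 XY] <-].
  by rewrite lee_pdivrMl//; exact: ge_emb.
(* The sufficiency bound is applied with real numbers slightly above [B], so [B = 0] needs no
   separate treatment; an infinite [B] makes the bound trivial. *)
case: B B0 le_emb {ge_emb} => [b||//] b0 le_emb; last by rewrite gt0_muley ?leey.
rewrite lee_fin in b0; apply/lee_addgt0Pr => e e0.
have el0 : (0 < e / lambda)%R by rewrite divr_gt0.
apply: (le_trans (le_emb (b + e / lambda)%R _ _)).
- by rewrite ltr_wpDl.
- by rewrite lte_fin ltrDl.
rewrite -EFinM -EFinD lee_fin.
apply: (@le_trans _ _ (lambda * (b + e / lambda))%R).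
  by rewrite ler_wpM2r// addr_ge0// ltW.
by rewrite mulrDr lerD2l mulrC divfK// gt_eqF.
Qed.

Lemma stieltjes_tail_functional (R : realType) (w : R -> R) (al : R)
    (G : R -> \bar R) : tail_function w -> (0 < al)%R ->
  (forall t, (0 < t)%R -> G t = (- (w t `^ al))%:E) ->
  tail_functional w al (fun F => stieltjes_integral F G).
Proof.
move=> tw al0 GE.
have -> : (fun F => stieltjes_integral F G) = (fun F : R -> \bar R =>
    \int[stieltjes_measure G]_(t in idfun @^-1` `]0%R, +oo[) (F (idfun t) * cst 1 t)).
  by apply/funext => F; apply: eq_integral => t _; rewrite mule1.
apply: (@integral_tail_functional R _ (measurableTypeR R)).
- exact: measurable_id.
- exact: measurable_cst.
- by [].
- exact: tw.
- exact: al0.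
- move=> x y x0 xy; rewrite integral_cst ?mul1e; last exact: measurable_itv.
  exact: (stieltjes_measure_itv _ _ _ tw al0 GE).
Qed.

Theorem theorem2p3 (R : realType) (n : nat) (p1 p2 theta1 theta2 : R)
    (p1_gt0 : (0 < p1)%R) (p2_gt0 : (0 < p2)%R)
    (theta1_gt0 : (0 < theta1)%R) (theta2_gt0 : (0 < theta2)%R)
    (theta2p2 : theta2 <> p2) (p2p1 : (p2 <= p1)%R) (p1theta1 : p1 = theta1) :
  exists lambda : R, (1 <= lambda)%R /\
  forall (v1 v2 : 'rV[R]_n.+1 -> \bar R) (omega1 omega2 : R -> \bar R),
  weight v1 -> weight v2 ->
  cOmega theta1%:E omega1 -> Omega theta2%:E omega2 ->
  let normI := embedding_norm
    (cLM p1%:E theta1%:E omega1 v1) (LM p2%:E theta2%:E omega2 v2)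
    (cLM_norm p1%:E theta1%:E omega1 v1) (LM_norm p2%:E theta2%:E omega2 v2) in
  let Phi (t : R) := norm_rV (arrow p1%:E p2%:E) (Ball t)
    (fun x : 'rV[R]_n.+1 =>
      (norm_R p1%:E `]0%R, euclid x[ omega1)^-1 * ((v1 x)^-1 * v2 x)) in
  let W (t : R) := norm_R theta2%:E `]t, +oo[ omega2 in
  let r := fine (arrow p1%:E theta2%:E) in
  ((p1 <= theta2)%R ->
    equiv_up_to lambda normI (ereal_sup [set Phi t * W t | t in `]0%R, +oo[]))
  /\
  ((theta2 < p1)%R ->
    equiv_up_to lambda normI
      (stieltjes_integral (fun t => Phi t `^ r) (fun t => - (W t `^ r))
        `^ r^-1)).
Proof.
rewrite -p1theta1 {theta1 theta1_gt0 p1theta1 theta2p2}.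
pose s := ((theta2^-1 - p1^-1)^-1)%R.
(* [C1] is the constant of sufficiency in (i). In (ii), [C2] and [C3] serve sufficiency and
   necessity; their extra factors come from comparing the Stieltjes integral with geometric sums,
   and the roots undo the powers [theta2] and [s]. Necessity in (i) has the constant
   [2 ^ theta2^-1]. *)
pose C1 := (hardy_const R p2 theta2 `^ theta2^-1)%R.
pose b := hardy_base R p2 theta2.
pose z := ((1 - b `^ (- (s / theta2)))^-1)%R.
pose C2 := (C1 * z `^ s^-1)%R.
pose b' := necessity_base R p1 p2 theta2.
pose C3 := ((b' `^ (s / theta2) * necessity_const R p1 p2 theta2) `^ s^-1)%R.
have [lambda [l1 lC1 lC2 lC3 lC4]] : exists lambda : R, [/\ (1 <= lambda)%R,
    (C1 <= lambda)%R, (C2 <= lambda)%R, (C3 <= lambda)%R &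
    (2 `^ theta2^-1 <= lambda)%R].
  exists (Num.max 1 (Num.max C1 (Num.max C2 (Num.max C3 (2 `^ theta2^-1)))))%R.
  by rewrite !le_max !lexx !orbT.
have C1_ge0 : (0 <= C1)%R by exact: powR_ge0.
have C3_ge0 : (0 <= C3)%R by exact: powR_ge0.
exists lambda.
split => // v1 v2 omega1 omega2 v1P v2P omega1P omega2P normI Phi W r.
pose T := caratheodory_type (@lebesgue_outer R n).
pose mu := [the {measure set T -> \bar R} of @lebesgue_measure_rV R n].
pose u : T -> \bar R := hardy_weight p1 v1 v2 omega1.
have mu_ : measurable_fun [set: T] u by exact: measurable_hardy_weight.
have u0 x : 0 <= u x by exact: hardy_weight_ge0.
have PhiE t : Phi t = 'N[mu]_(arrow p1%:E p2%:E)[u \_ (Ball t)].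
  rewrite /Phi /norm_rV -Lnorm_abse; congr Lnorm; apply/funext => x.
  by rewrite /= /patch; case: ifP => // _; rewrite abse0.
pose w := weight_tail theta2 omega2.
have tw : tail_function w by exact: weight_tail_tail_function.
have WE t : (0 < t)%R -> W t = (w t `^ theta2^-1)%:E by move=> t0; exact: weight_tailE.
have tE := weight_tail_functional _ _ theta2_gt0 omega2P.
have mB t : measurable (Ball t : set T) by exact: measurable_Ball.
have ndB a c : (a <= c)%R -> (Ball a : set T) `<=` Ball c.
  by move=> ac x xa; exact: lt_le_trans ac.
have w0 t : (0 < t)%R -> (0 < w t)%R by have [h _ _] := tw; exact: h.
have Wt0 t : (0 < t)%R -> (0 < w t `^ theta2^-1)%R by move=> t0; rewrite powR_gt0 ?w0.
have hc_split (D l : R) : (0 <= D)%R -> (0 <= l)%R ->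
    (hardy_const R p2 theta2 * (l * D) `^ theta2 = (C1 * D * l) `^ theta2)%R.
  move=> D0 l0; have -> : (C1 * D * l = C1 * (l * D))%R by rewrite -mulrA (mulrC D).
  have hc0 : (0 <= hardy_const R p2 theta2)%R by rewrite /hardy_const !mulr_ge0 ?powR_ge0.
  rewrite [RHS]powRM ?mulr_ge0// /C1 -[((hardy_const _ _ _ `^ _) `^ _)%R]powRrM.
  by rewrite mulVf ?gt_eqF// powRr1.
have b1 : (1 < b)%R by exact: hardy_base_gt1.
have b0 : (0 < b)%R by exact: lt_trans b1.
pose E F := \int[@completed_lebesgue_measure R]_(t in `]0%R, +oo[)
  (F t * `|omega2 t| `^ theta2).
pose Hg (g : T -> \bar R) a := \int[mu]_(x in Ball a) ((g x * u x) `^ p2).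
have le_emb (D : R) : (0 < D)%R ->
    (forall t, (0 < t)%R -> 'N[mu]_(arrow p1%:E p2%:E)[u \_ (Ball t)] < +oo) ->
    (forall l t K (beta : nat -> \bar R), (0 < l)%R -> geometric_seq w b t ->
      (forall k, 0 <= beta k) -> \sum_(k < K) beta k `^ p1 <= (l `^ p1)%:E ->
      \sum_(k < K) (beta k * 'N[mu]_(arrow p1%:E p2%:E)[u \_ (Ball (t k))]) `^ theta2
        * (w (t k) `^ 1)%:E <= (2 * (l * D) `^ theta2)%:E) ->
    normI <= (C1 * D)%:E.
  move=> D0 Psiy key.
  apply: (embedding_norm_le _ _ _ p1_gt0 p2_gt0 p2p1 theta2_gt0 _ _ _ _ v1P v2P omega1P).
  - by rewrite mulr_ge0// ltW.
  - exact: Psiy.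
  - move=> g l mg g0 l0 gl; rewrite -hc_split ?(ltW D0) ?(ltW l0)//.
    apply: (hardy_sufficient _ T R mu _ _ _ p1_gt0 p2_gt0 p2p1 theta2_gt0 _ mB ndB
      u mu_ u0 w tw _ tE D l g D0 l0 Psiy _ mg g0 gl) => t K beta.
    exact: key.
have hardy_c c := embedding_hardy _ _ _ p1_gt0 p2_gt0 theta2_gt0 v1 v2 omega1 omega2 v1P v2P omega1P c.
have tail_le c c0 XY := arrow_norm_tail_le _ T R mu lebesgue_measure_rV_sigma_finite
  _ _ _ p1_gt0 p2_gt0 p2p1 theta2_gt0 _ mB ndB u mu_ u0 w tw _ tE c c0 (hardy_c c c0 XY).
split=> [p1th|thp1].
  apply: (equiv_up_to_embedding_norm _ _ _ _ _ _ _ _ C1).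
  - apply: (@le_trans _ _ (Phi 1%R * W 1%R)); first by rewrite mule_ge0// Lnorm_ge0.
    by apply: ereal_sup_ubound; exists 1%R => //=; rewrite in_itv/= ltr01.
  - exact: l1.
  - exact: lC1.
  - move=> D D0 supD.
    have PW t : (0 < t)%R ->
        'N[mu]_(arrow p1%:E p2%:E)[u \_ (Ball t)] * (w t `^ theta2^-1)%:E <= D%:E.
      move=> t0; rewrite -PhiE -WE//; apply: le_trans (ltW supD).
      by apply: ereal_sup_ubound; exists t => //=; rewrite in_itv/= t0.
    apply: le_emb => //.
      move=> t t0; have := PW t t0; rewrite -lee_pdivlMr ?Wt0// -EFinM => h.
      exact: le_lt_trans h (ltry _).
    move=> l t K beta l0 gt beta0 hbeta.
    exact: (geometric_key_le _ T R mu _ _ _ p1_gt0 theta2_gt0 _ _ w tw D l p1th D0 l0 PW b).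
  - move=> c c0 XY; apply: ge_ereal_sup => _ [t /= t0 <-].
    rewrite in_itv/= andbT in t0; rewrite PhiE WE//.
    apply: le_trans (tail_le c c0 XY t t0) _.
    by rewrite lee_fin ler_wpM2r.
have s0 : (0 < s)%R by rewrite invr_gt0 subr_gt0 ltf_pV2.
have rs : r = s by rewrite /r arrow_lt.
rewrite rs.
pose EI F := stieltjes_integral F (fun t => - (W t `^ s)).
have sth0 : (0 < s / theta2)%R by rewrite divr_gt0.
(* Since [W t ^ s = w t ^ (s / theta2)], the Stieltjes integral is compared with sums along the same
   sequences as the integral defining the target norm. *)
have tEI : tail_functional w (s / theta2) EI.
  apply: stieltjes_tail_functional => // t t0.
  by rewrite WE// poweR_EFin -powRrM (mulrC theta2^-1)%R.
have ndPhi : nondecreasing_pos (fun t => Phi t `^ s).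
  have := nondecreasing_pos_arrow_norm _ T R mu _ _ p1_gt0 p2_gt0 p2p1 _ mB ndB u mu_ u0 s (ltW s0).
  by under eq_fun do rewrite -PhiE.
have EI0 : 0 <= EI (fun t => Phi t `^ s) by apply: integral_ge0 => t _; exact: poweR_ge0.
apply: (equiv_up_to_embedding_norm _ _ _ _ _ _ _ _ C2).
- exact: poweR_ge0.
- exact: l1.
- exact: lC2.
- move=> d d0 EId.
  have z0 : (0 < z)%R.
    rewrite invr_gt0 subr_gt0 powRN invf_lt1 ?powR_gt0//.
    by have := @gt0_ltr_powR _ _ sth0 1%R b; rewrite powR1; apply; rewrite ?nnegrE// ltW.
  have D0 : (0 < z `^ s^-1 * d)%R by rewrite mulr_gt0// powR_gt0.
  have [low _] := tEI _ _ b1 ndPhi.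
  have sumD t K : geometric_seq w b t ->
      \sum_(k < K) 'N[mu]_(arrow p1%:E p2%:E)[u \_ (Ball (t k))] `^ s *
        (w (t k) `^ (s / theta2))%:E <= ((z `^ s^-1 * d) `^ s)%:E.
    move=> gt; under eq_bigr do rewrite -PhiE.
    apply: (le_trans (low t K gt)).
    rewrite powRM ?powR_ge0 ?(ltW d0)// -powRrM mulVf ?gt_eqF// powRr1 ?(ltW z0)//.
    rewrite EFinM lee_wpmul2l ?lee_fin ?(ltW z0)// -poweR_EFin.
    by rewrite -[X in X <= _](@poweRVK _ s) ?gt_eqF// le_poweR ?(ltW s0) ?poweR_ge0// ltW.
  rewrite /C2 -mulrA; apply: le_emb => //.
    (* A one-term sum along a sequence starting at [t] shows that the norm over [Ball t] is
       finite. *)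
    move=> t t0; have [t' gt tt'] := exists_geometric_seq _ _ _ tw b1 t0.
    have := sumD t' 1%N gt; rewrite big_ord1 tt'.
    have wt0 : (0 < w t `^ (s / theta2))%R by rewrite powR_gt0 ?w0.
    rewrite -lee_pdivlMr// -EFinM => h; apply: (@lty_poweRy _ _ s); first by rewrite gt_eqF.
    exact: le_lt_trans h (ltry _).
  move=> l t K beta l0 gt beta0 hbeta.
  exact: (geometric_key_gt _ T R mu _ _ _ p1_gt0 theta2_gt0 _ _ w _ l b thp1 D0 l0 sumD).
- move=> c c0 XY.
  (* The ratio differs from the one used for sufficiency; the comparison with sums holds for every
     ratio above 1. *)
  have b'1 : (1 < b')%R by exact: necessity_base_gt1.
  have [_ up] := tEI _ _ b'1 ndPhi.
  have : EI (fun t => Phi t `^ s) <=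
      (b' `^ (s / theta2))%:E * (necessity_const R p1 p2 theta2 * c `^ s)%:E.
    apply: up => t K gt; under eq_bigr do rewrite PhiE.
    exact: (arrow_norm_geometric_sum_le _ T R mu lebesgue_measure_rV_sigma_finite
      _ _ _ p1_gt0 p2_gt0 p2p1 theta2_gt0 _ mB ndB u mu_ u0 w tw _ tE c c0 (hardy_c c c0 XY)).
  rewrite -EFinM mulrA => h.
  apply: (@le_trans _ _ ((C3 * c)%:E)); last first.
    by rewrite lee_fin ler_wpM2r.
  have C3c0 : 0 <= (C3 * c)%:E by rewrite lee_fin (mulr_ge0 C3_ge0 c0).
  rewrite -(@lee_poweR2 _ s _ _ s0 (poweR_ge0 _ _) C3c0).
  rewrite poweRVK ?gt_eqF//; apply: (le_trans h).
  have nc0 : (0 <= b' `^ (s / theta2) * necessity_const R p1 p2 theta2)%R.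
    by rewrite mulr_ge0 ?powR_ge0// /necessity_const !mulr_ge0 ?powR_ge0// invr_ge0 subr_ge0.
  rewrite poweR_EFin lee_fin (powRM _ C3_ge0 c0) /C3 -[X in (_ <= X * _)%R]powRrM.
  by rewrite mulVf ?gt_eqF// powRr1.
Qed.
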